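(* Let $f:[0,1]\to(0,1)$ be a $C^3$ function whose fixed points are isolated, and assume $f\ge 1/2$ on $[0,1]$. Let $w_0=(\alpha_0^x,l_0^x)_{x\in\mathbb{Z}}\in([0,1]\times(0,+\infty))^{\mathbb{Z}}$ be an initial environment such that $w_0^x=w_0^1$ for all $x\ge 1$. Let $X$ be the generalized reinforced random walk associated to $f$ with law $\mathbb{P}_{0,w_0}$. Then $X$ is almost surely recurrent if and only if $\mathbb{E}[\delta^1_\infty]\le 1$.
   Context: Urn process associated to $f$: a Markov chain $((\alpha_n,l_n),n\ge 0)$ on $[0,1]\times(0,+\infty)$ with $l_{n+1}=l_n+1$, and $\alpha_{n+1}=(l_n\alpha_n+1)/(l_n+1)$ with probability $f(\alpha_n)$, $\alpha_{n+1}=l_n\alpha_n/(l_n+1)$ with probability $1-f(\alpha_n)$. Generalized reinforced random walk started at $(0,w_0)$ associated to $f$: $X_0=0$; for $x\in\mathbb{Z}$, $n\ge0$ let $L_n^x=\sum_{k=0}^{n-1}1_{\{X_k=x\}}$ and $\tilde\alpha_n^x=\frac{1}{l_0^x+L_n^x}\big(\alpha_0^xl_0^x+\sum_{k=0}^{n-1}1_{\{X_k=x,X_{k+1}=x+1\}}\big)$; given the past, if $X_n=x$ then $X_{n+1}=x+1$ with probability $f(\tilde\alpha_n^x)$ and $X_{n+1}=x-1$ otherwise. Its law is denoted $\mathbb{P}_{0,w_0}$ (and $\mathbb{P}_{k,w_0}$ when started at $k$). The walk is recurrent if it visits every site infinitely often. $\delta^1_\infty:=\sum_{k\ge 0}(2f(\alpha_k)-1)$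 where $(\alpha_k,l_k)_{k\ge0}$ is an urn process associated to $f$ started from $(\alpha_0,l_0)=w_0^1$; $\mathbb{E}$ denotes expectation for this urn process. *)

(* Defs.v *)
From HB Require Import structures.
From mathcomp Require Import all_boot all_order all_algebra.
From mathcomp Require Import all_classical all_reals all_analysis.
Set Implicit Arguments. Unset Strict Implicit. Unset Printing Implicit Defensive.
Import Order.TTheory GRing.Theory Num.Theory.
Import numFieldNormedType.Exports.
Local Open Scope ring_scope.
Local Open Scope classical_set_scope.

Section Defs.
Variable R : realType.

Definition C3_on_01 (f : R -> R) : Prop :=
  exists g : R -> R,
    (forall x, 0 <= x <= 1 -> g x = f x) /\
    (forall k x, (k < 3)%N -> derivable (derive1n k g) x 1) /\
    continuous (derive1n 3 g).

Definition isolated_fixed_points (f : R -> R) : Prop :=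
  forall x, 0 <= x <= 1 -> f x = x ->
    exists2 e : R, 0 < e &
      forall y, 0 <= y <= 1 -> f y = y -> `|y - x| < e -> y = x.

Definition Lvis (p : seq int) (k : nat) (x : int) : nat :=
  (\sum_(j < k) (nth 0%R p j == x))%N.
Definition Uvis (p : seq int) (k : nat) (x : int) : nat :=
  (\sum_(j < k) ((nth 0%R p j == x) && (nth 0%R p j.+1 == (x + 1)%R)))%N.

Definition alpha_tilde (a0 l0 : int -> R) (p : seq int) (k : nat) : R :=
  let x := nth 0%R p k in
  (a0 x * l0 x + (Uvis p k x)%:R) / (l0 x + (Lvis p k x)%:R).

Definition walk_step_prob (f : R -> R) (a0 l0 : int -> R) (p : seq int)
    (k : nat) : R :=
  let x := nth 0%R p k in
  let y := nth 0%R p k.+1 in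
  if y == x + 1 then f (alpha_tilde a0 l0 p k)
  else if y == x - 1 then 1 - f (alpha_tilde a0 l0 p k)
  else 0.

Definition walk_path_prob (f : R -> R) (a0 l0 : int -> R) (p : seq int) : R :=
  (nth 0%R p 0 == 0)%:R * \prod_(k < (size p).-1) walk_step_prob f a0 l0 p k.

Definition urn_step_prob (f : R -> R) (l a b : R) : R :=
  (if b == (l * a + 1) / (l + 1) then f a else 0) +
  (if b == (l * a) / (l + 1) then 1 - f a else 0).

(* P(alpha_0 = s_0, ..., alpha_n = s_n) for s = [:: s_0; ...; s_n],
   where the urn starts at (a, l) and l_k = l + k *)
Definition urn_path_prob (f : R -> R) (a l : R) (s : seq R) : R :=
  (nth 0%R s 0 == a)%:R *
  \prod_(k < (size s).-1) urn_step_prob f (l + k%:R) (nth 0%R s k) (nth 0%R s k.+1).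

End Defs.

(* Main.v *)
Require Import Defs.
From HB Require Import structures.
From mathcomp Require Import all_boot all_order all_algebra.
From mathcomp Require Import all_classical all_reals all_analysis.
From mathcomp Require Import measurable_realfun ring lra zify.
Import Order.TTheory GRing.Theory Num.Theory.
Import numFieldNormedType.Exports.
Local Open Scope ring_scope.
Local Open Scope classical_set_scope.

(** Let W(q) be the mean drift that an urn in state q still has to produce, so that
    W = E[delta] in the initial state.  Since W compensates the drift of the walk, the
    position plus the sum of W over the sites 1, ..., K-1 is a martingale until K is hit.

    Recurrent walk: the part of the walk seen on [x, oo) does not depend on x, so each site x
    is visited many times before x + m, uniformly in x; hence reaching K costs a
    drift of about K W, which is at most K, and W <= 1.

    W <= 1: let q_K be the chance that, in the initial environment, the walk started at 1
    hits K before 0.  Optional stopping gives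
      K q_K = 1 + sum_(0 < x < K) (q_x W - drift left at x when x was visited).
    If p = lim q_K > 0, then x is visited just once with chance bounded below, so the mean
    drift left is at least some c > 0 as soon as W is positive (if W vanished after one
    move to the right, then f = 1/2 on a dense set).  As q_x -> p this contradicts W <= 1.
    So p = 0.  A history of the walk shifted by 1 can be followed by the walk started
    at 1 without hitting 0, so no history allows an escape to infinity without
    returning to 0; since the drift is nonnegative, escape to -oo is impossible as well. *)

(** * Chains with two moves *)

(** Nothing says in advance that E[delta] is finite, and both laws are known only through the
    probabilities of finite paths. The estimates therefore live on a finite horizon: means are
    computed by recursion on the number of moves ([ev]), W is truncated to [urn_drift N], and the
    price of the horizon is [survival], the chance of not having stopped yet. Quadratic potentials
    make this price small, since a nonnegative drift takes the walk out of (0, K), or up to a given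
    level, within a prescribed time with chance close to 1. Infinite trajectories enter only
    afterwards. Moves are coded by booleans, so histories are countably many, and recurrence can
    fail only on a countable union of events whose probabilities are bounded through [hit].
    Compactness turns [f < 1] into [f <= 1 - eps]. Each move then has chance at least [eps], so any
    history can be followed with positive chance and no site is left forever in the same
    direction. *)

Section Chain.
Context {R : realType} {S : Type}.
Variables (p : S -> R) (nx : bool -> S -> S).
Implicit Types (phi psi : S -> R) (s : S) (stop D C : pred S).

Definition step phi s := p s * phi (nx true s) + (1 - p s) * phi (nx false s).

(** Mean of [phi] at the first time [stop] holds, or at time [n] if that is earlier. With the
    recursion on the first move, optional stopping is an induction on [n]. *)
Fixpoint ev stop n phi s :=
  if n is n'.+1 then if stop s then phi s else step (ev stop n' phi) s
  else phi s.

(** Chance of meeting [D] within [n] moves and before [C]; a state in both counts as a success. *)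
Definition hit D C n := ev (predU D C) n (fun s => (D s)%:R).

Definition run s (b : seq bool) := foldl (fun t d => nx d t) s b.

Fixpoint weight s (b : seq bool) : R :=
  if b is d :: b' then (if d then p s else 1 - p s) * weight (nx d s) b' else 1.

Lemma run_rcons s b d : run s (rcons b d) = nx d (run s b).
Proof. by rewrite /run foldl_rcons. Qed.

Lemma weight_rcons s b d :
  weight s (rcons b d) = weight s b * (if d then p (run s b) else 1 - p (run s b)).
Proof.
elim: b s => [|d' b IH] s /=; first by rewrite mulr1 mul1r.
by rewrite IH mulrA.
Qed.

Lemma evS stop n phi s : ~~ stop s ->
  ev stop n.+1 phi s = step (ev stop n phi) s.
Proof. by move=> /= /negbTE ->. Qed.

Lemma ev_stop stop n phi s : stop s -> ev stop n phi s = phi s.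
Proof. by case: n => //= n ->. Qed.

Lemma hitS D C n s : ~~ D s -> ~~ C s -> hit D C n.+1 s = step (hit D C n) s.
Proof. by move=> Ds Cs; rewrite /hit evS //= negb_or Ds Cs. Qed.

Lemma hit1 D C n s : D s -> hit D C n s = 1.
Proof. by move=> Ds; rewrite /hit ev_stop /= Ds. Qed.

Lemma hit0 D C n s : ~~ D s -> C s -> hit D C n s = 0.
Proof.
by move=> Ds Cs; rewrite /hit ev_stop ?(negbTE Ds)//= Cs orbT.
Qed.

Lemma hit0n D C s : ~~ D s -> hit D C 0 s = 0.
Proof. by move=> /negbTE Ds; rewrite /hit /= Ds. Qed.

Lemma step_cst (c : R) s : step (fun=> c) s = c.
Proof. by rewrite /step -mulrDl addrC subrK mul1r. Qed.

Lemma eq_step phi psi s : (forall d, phi (nx d s) = psi (nx d s)) ->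
  step phi s = step psi s.
Proof. by rewrite /step => e; rewrite !e. Qed.

Lemma stepD phi psi s : step (fun t => phi t + psi t) s = step phi s + step psi s.
Proof. by rewrite /step; ring. Qed.

Lemma stepZ (c : R) phi s : step (fun t => c * phi t) s = c * step phi s.
Proof. by rewrite /step; ring. Qed.

Lemma step_sum (I : Type) (r : seq I) (phi : I -> S -> R) s :
  step (fun t => \sum_(i <- r) phi i t) s = \sum_(i <- r) step (phi i) s.
Proof.
elim: r => [|i r IH].
  rewrite big_nil -[RHS](step_cst 0 s); apply: eq_step => d.
  by rewrite big_nil.
rewrite big_cons -IH -stepD; apply: eq_step => d.
by rewrite big_cons.
Qed.

Lemma ev_cst stop n (c : R) s : ev stop n (fun=> c) s = c.
Proof.
elim: n s => //= n IH s; case: ifP => // _.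
by rewrite -[RHS](step_cst c s); apply: eq_step.
Qed.

Lemma evD stop n phi psi s :
  ev stop n (fun t => phi t + psi t) s = ev stop n phi s + ev stop n psi s.
Proof.
elim: n s => //= n IH s; case: ifP => // _.
by rewrite -stepD; apply: eq_step.
Qed.

Lemma evZ stop n (c : R) phi s :
  ev stop n (fun t => c * phi t) s = c * ev stop n phi s.
Proof.
elim: n s => //= n IH s; case: ifP => // _.
by rewrite -stepZ; apply: eq_step.
Qed.

Lemma ev_sum (I : Type) (r : seq I) stop n (phi : I -> S -> R) s :
  ev stop n (fun t => \sum_(i <- r) phi i t) s = \sum_(i <- r) ev stop n (phi i) s.
Proof.
elim: n s => //= n IH s; case: ifP => // _.
by rewrite -step_sum; apply: eq_step.
Qed.

Hypothesis p01 : forall s, 0 <= p s <= 1.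

Lemma step_le phi psi s : (forall d, phi (nx d s) <= psi (nx d s)) ->
  step phi s <= step psi s.
Proof.
move=> le; have /andP[p0 p1] := p01 s.
by rewrite lerD// ler_wpM2l// subr_ge0.
Qed.

Lemma step_le_cst phi (c : R) s : (forall d, phi (nx d s) <= c) ->
  step phi s <= c.
Proof. by move=> le; rewrite -[leRHS](step_cst c s); exact: step_le. Qed.

Lemma step_ge_cst phi (c : R) s : (forall d, c <= phi (nx d s)) ->
  c <= step phi s.
Proof. by move=> le; rewrite -[leLHS](step_cst c s); exact: step_le. Qed.

Lemma ev_le_in (I : S -> Prop) stop n phi psi s :
  (forall t d, I t -> ~~ stop t -> I (nx d t)) ->
  (forall t, I t -> phi t <= psi t) -> I s -> ev stop n phi s <= ev stop n psi s.
Proof.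
move=> Inx le; elim: n s => [|n IH] s Is /=; first exact: le.
case: ifPn => st; first exact: le.
by apply: step_le => d; apply: IH; exact: Inx.
Qed.

Lemma ev_le stop n phi psi s :
  (forall t, phi t <= psi t) -> ev stop n phi s <= ev stop n psi s.
Proof. by move=> le; apply: (@ev_le_in (fun=> True)). Qed.

(** Optional stopping for submartingales. The invariant [I] has to survive only the moves made
    before stopping, so it may confine the walk to an interval. *)
Lemma ev_sub (I : S -> Prop) stop n phi s :
  (forall t d, I t -> ~~ stop t -> I (nx d t)) ->
  (forall t, I t -> ~~ stop t -> phi t <= step phi t) ->
  I s -> phi s <= ev stop n phi s.
Proof.
move=> Inx le; elim: n s => [|n IH] s Is //=; case: ifPn => // st.
apply: le_trans (le _ Is st) _; apply: step_le => d; apply: IH.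
exact: Inx.
Qed.

Lemma weight_ge0 s b : 0 <= weight s b.
Proof.
elim: b s => //= d b IH s; rewrite mulr_ge0//.
by have /andP[p0 p1] := p01 s; case: d; rewrite ?subr_ge0.
Qed.

Lemma weight_le1 s b : weight s b <= 1.
Proof.
elim: b s => //= d b IH s; rewrite mulr_ile1 ?weight_ge0//.
  by have /andP[p0 p1] := p01 s; case: d; rewrite ?subr_ge0.
by have /andP[p0 p1] := p01 s; case: d; rewrite ?gerBl.
Qed.

Lemma hit_ge0 D C n s : 0 <= hit D C n s.
Proof.
by rewrite -[leLHS](ev_cst (predU D C) n 0 s); apply: ev_le => t; rewrite ler0n.
Qed.

Lemma hit_le1 D C n s : hit D C n s <= 1.
Proof.
rewrite -[leRHS](ev_cst (predU D C) n 1 s); apply: ev_le => t.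
by rewrite lern1 leq_b1.
Qed.

Lemma hit_leS D C n s : hit D C n s <= hit D C n.+1 s.
Proof.
elim: n s => [|n IH] s.
  have [Ds|Ds] := boolP (D s); first by rewrite !hit1.
  by rewrite hit0n// hit_ge0.
have [Ds|Ds] := boolP (D s); first by rewrite !hit1.
have [Cs|Cs] := boolP (C s); first by rewrite !hit0.
by rewrite hitS// [leRHS]hitS//; apply: step_le.
Qed.

Lemma hit_mono D C n m s : (n <= m)%N -> hit D C n s <= hit D C m s.
Proof.
elim: m => [|m IH]; first by rewrite leqn0 => /eqP ->.
by rewrite leq_eqVlt => /predU1P[->//|/IH /le_trans]; apply; exact: hit_leS.
Qed.

End Chain.

(** * Walks with nonnegative drift *)

(** The numbers of right and left moves made from each site, and the position: with these the
    reinforced walk becomes a Markov chain. *)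
Definition wstate : Type := ((int -> nat * nat) * int)%type.

Definition tally (d : bool) (q : nat * nat) : nat * nat :=
  if d then (q.1.+1, q.2) else (q.1, q.2.+1).

Definition move (d : bool) (s : wstate) : wstate :=
  (fun z => if z == s.2 then tally d (s.1 z) else s.1 z,
   if d then s.2 + 1 else s.2 - 1).

Definition pright {R : realType} (E : int -> nat * nat -> R) (s : wstate) : R :=
  E s.2 (s.1 s.2).

Section Walk.
Context {R : realType}.
Variable E : int -> nat * nat -> R.
Hypothesis E_half : forall z q, 2^-1 <= E z q <= 1.
Implicit Types (s : wstate) (stop D C : pred wstate).

Local Notation pr := (pright E).
Local Notation ev := (ev pr move).
Local Notation hit := (hit pr move).
Local Notation step := (step pr move).

Lemma pr_ge s : 2^-1 <= pr s. Proof. by have /andP[] := E_half s.2 (s.1 s.2). Qed.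

Lemma pr01 s : 0 <= pr s <= 1.
Proof.
have := E_half s.2 (s.1 s.2); rewrite -/(pr s) => /andP[h ->]; rewrite andbT.
by rewrite (le_trans _ h)// invr_ge0.
Qed.

Definition survival stop n : wstate -> R := ev stop n (fun s => (~~ stop s)%:R).

Lemma survival_stop stop n s : stop s -> survival stop n s = 0.
Proof. by move=> st; rewrite /survival ev_stop// st. Qed.

Lemma survival_ge0 stop n s : 0 <= survival stop n s.
Proof.
by rewrite -[leLHS](ev_cst pr move stop n 0 s); apply: (ev_le _ _ pr01) => t; rewrite ler0n.
Qed.

Lemma survival_le1 stop n s : survival stop n s <= 1.
Proof.
rewrite -[leRHS](ev_cst pr move stop n 1 s); apply: (ev_le _ _ pr01) => t.
by rewrite lern1 leq_b1.
Qed.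

(* The square of the position gains at least 1 in mean at each step made in (0, K). *)
Lemma exit_interval (K n : nat) s : 0 <= s.2 <= K%:Z ->
  n%:R * survival (fun t => (t.2 == 0) || (t.2 == K%:Z)) n s <= K%:R ^+ 2.
Proof.
move=> sK; apply: (@le_trans _ _ (K%:R ^+ 2 - (s.2)%:~R ^+ 2)); last first.
  by rewrite gerBl sqr_ge0.
elim: n s sK => [|n IH] s sK.
  rewrite mul0r subr_ge0 ler_sqr ?nnegrE ?ler0n ?ler0z; [|lia|lia].
  by rewrite -[K%:R]/((K%:Z)%:~R) ler_int; lia.
have [st|st] := boolP ((s.2 == 0) || (s.2 == K%:Z)).
  rewrite survival_stop// mulr0 subr_ge0 ler_sqr ?nnegrE ?ler0n ?ler0z; [|lia|lia].
  by rewrite -[K%:R]/((K%:Z)%:~R) ler_int; lia.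
set stop := fun _ => _.
have le1 : survival stop n.+1 s <= 1 by exact: survival_le1.
have -> : n.+1%:R * survival stop n.+1 s =
    step (fun t => n%:R * survival stop n t) s + survival stop n.+1 s.
  rewrite stepZ /survival evS// -natr1; ring.
have le2 : step (fun t => n%:R * survival stop n t) s <=
    step (fun t => K%:R ^+ 2 - (t.2)%:~R ^+ 2) s.
  by apply: (step_le _ _ pr01) => d; apply: IH; case: d => /=; lia.
apply: le_trans (lerD le2 le1) _.
rewrite /step /= rmorphB rmorphD /=.
have := pr_ge s; have : 0 <= (s.2)%:~R :> R by rewrite ler0z; lia.
move: (s.2)%:~R (pr s) => x p x0 ph.
(* One move turns [x ^+ 2] into [x ^+ 2 + 1 + 2 * x * (2 * p - 1)] in mean. *)
have : 0 <= x * (2 * p - 1) by rewrite mulr_ge0//; lra.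
nra.
Qed.

(* With Y = K - pos, the potential M^2 - max(M-Y,0)^2 loses 1 in mean per step while
   0 < Y < M, and Y is a supermartingale, which bounds the mass at Y >= M. *)
Lemma survival_bound (K : int) (M n : nat) s : (0 < M)%N -> s.2 <= K ->
  n%:R * survival (fun t => t.2 == K) n s <=
    M%:R ^+ 2 + n%:R * ((K - s.2)%:~R / M%:R).
Proof.
move=> M0 sK.
pose phi (y : R) := M%:R ^+ 2 - Num.max (M%:R - y) 0 ^+ 2.
have M0R : 0 < M%:R :> R by rewrite ltr0n.
set stop := fun _ => _.
apply: (@le_trans _ _ (phi (K - s.2)%:~R + n%:R * ((K - s.2)%:~R / M%:R))); last first.
  by rewrite lerD2r gerBl sqr_ge0.
have phi0 (y : R) : 0 <= y -> 0 <= phi y.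
  move=> y0; rewrite subr_ge0 ler_sqr ?nnegrE ?le_max ?lexx ?orbT ?ler0n//.
  by rewrite ge_max ler0n andbT gerBl.
elim: n s sK => [|n IH] s sK.
  by rewrite mul0r mul0r addr0; apply: phi0; rewrite ler0z; lia.
have y0 : 0 <= (K - s.2)%:~R :> R by rewrite ler0z; lia.
have [st|st] := boolP (stop s).
  by rewrite survival_stop// mulr0 addr_ge0 ?phi0// mulr_ge0 ?ler0n// divr_ge0// ltW.
have le1 : survival stop n.+1 s <= 1 by exact: survival_le1.
have -> : n.+1%:R * survival stop n.+1 s =
    step (fun t => n%:R * survival stop n t) s + survival stop n.+1 s.
  rewrite stepZ /survival evS// -natr1; ring.
have st' : s.2 != K by [].
have le2 : step (fun t => n%:R * survival stop n t) s <=
    step (fun t => phi (K - t.2)%:~R + n%:R * ((K - t.2)%:~R / M%:R)) s.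
  by apply: (step_le _ _ pr01) => d; apply: IH; case: d => /=; lia.
rewrite -(natr1 n) mulrDl mul1r.
(* A step is paid for by the loss of potential when [Y < M], and by [Y / M >= 1] otherwise. *)
have le3 : survival stop n.+1 s <= (K - s.2 < M%:Z)%R%:R + (K - s.2)%:~R / M%:R.
  apply: le_trans le1 _; case: ltP => h /=; first by rewrite lerDl divr_ge0// ltW.
  by rewrite add0r ler_pdivlMr// mul1r -[M%:R]/((M%:Z)%:~R) ler_int.
apply: le_trans (lerD le2 le3) _.
rewrite stepD stepZ.
have e1 d : (K - (move d s).2)%:~R = (K - s.2)%:~R + (if d then -1 else 1) :> R.
  by case: d => /=; rewrite !rmorphB ?rmorphD /=; ring.
suff : step (fun t => phi (K - t.2)%:~R) s <= phi (K - s.2)%:~R - (K - s.2 < M%:Z)%R%:R.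
  have : n%:R * step (fun t => (K - t.2)%:~R / M%:R) s <= n%:R * ((K - s.2)%:~R / M%:R).
    rewrite ler_wpM2l ?ler0n// /step !e1 !mulrA -mulrDl.
    rewrite ler_wpM2r ?invr_ge0 ?(ltW M0R)//.
    by have := pr_ge s; move: (pr s) => p ph; nra.
  lra.
rewrite /step !e1.
have : if K - s.2 < M%:Z then (K - s.2)%:~R + 1 <= M%:R :> R else M%:R <= (K - s.2)%:~R :> R.
  by rewrite -[M%:R]/((M%:Z)%:~R) -(intrD _ _ 1) !ler_int; case: ifP; lia.
have := pr_ge s; have /andP[_] := pr01 s.
move: (pr s) y0 => p; move: (K - s.2)%:~R => y y0 p1 ph.
rewrite /phi; case: ifP => _ h /=.
  rewrite !max_l; [|lra|lra|lra].
  nra.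
rewrite [Num.max (M%:R - y) 0]max_r; last lra.
have := sqr_ge0 (Num.max (M%:R - (y + -1)) 0).
have := sqr_ge0 (Num.max (M%:R - (y + 1)) 0).
move: (_ ^+ 2) => a; move: (Num.max _ _ ^+ 2) => b a0 b0.
nra.
Qed.

End Walk.

(** * Compensation of the drift by the urns *)

Section Urn.
Context {R : realType}.
Variable F : nat * nat -> R.
Hypothesis F_half : forall q, 2^-1 <= F q <= 1.

Lemma F01 q : 0 <= F q <= 1.
Proof. by have /andP[h ->] := F_half q; rewrite (le_trans _ h)// invr_ge0. Qed.

Definition drift q := 2 * F q - 1.

Lemma drift_ge0 q : 0 <= drift q.
Proof. by have /andP[h _] := F_half q; rewrite /drift; lra. Qed.

Lemma drift_le1 q : drift q <= 1.
Proof. by have /andP[_ h] := F_half q; rewrite /drift; lra. Qed.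

(** W restricted to the next [N] draws. *)
Definition urn_drift N q := \sum_(k < N) ev F tally xpred0 k drift q.

Lemma urn_drift0 q : urn_drift 0 q = 0. Proof. by rewrite /urn_drift big_ord0. Qed.

Lemma urn_driftS N q :
  urn_drift N.+1 q = drift q + step F tally (urn_drift N) q.
Proof. by rewrite /urn_drift big_ord_recl /= step_sum. Qed.

Lemma urn_drift_term_ge0 k q : 0 <= ev F tally xpred0 k drift q.
Proof.
rewrite -[leLHS](ev_cst F tally xpred0 k 0 q); apply: (ev_le _ _ F01) => t.
exact: drift_ge0.
Qed.

Lemma urn_drift_ge0 N q : 0 <= urn_drift N q.
Proof. by apply: sumr_ge0 => k _; exact: urn_drift_term_ge0. Qed.

Lemma urn_drift_leS N q : urn_drift N q <= urn_drift N.+1 q.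
Proof. by rewrite /urn_drift big_ord_recr/= lerDl urn_drift_term_ge0. Qed.

Lemma urn_drift_mono N M q : (N <= M)%N -> urn_drift N q <= urn_drift M q.
Proof.
elim: M => [|M IH]; first by rewrite leqn0 => /eqP ->.
by rewrite leq_eqVlt => /predU1P[->//|/IH /le_trans]; apply; exact: urn_drift_leS.
Qed.

Lemma urn_drift_le N q : urn_drift N q <= N%:R.
Proof.
rewrite -[N in leRHS]card_ord -sum1_card natr_sum; apply: ler_sum => k _.
rewrite -[leRHS](ev_cst F tally xpred0 k 1 q); apply: (ev_le _ _ F01) => t.
exact: drift_le1.
Qed.

End Urn.

(** Spreads the drift of the current move over the sites, to be compared site by site with the loss
    of W. *)
Lemma sum_delta (R : realType) (K : nat) (y : int) (c : R) : 0 < y < K%:Z ->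
  \sum_(1 <= x < K) (x%:Z == y)%:R * c = c.
Proof.
move=> yK; have -> : y = `|y|%N%:Z by lia.
rewrite (bigD1_seq `|y|%N) ?iota_uniq ?mem_index_iota//=; last by lia.
rewrite eqxx mul1r big1 ?addr0// => i /negbTE.
by rewrite eqz_nat => ->; rewrite mul0r.
Qed.

(** * Reaching a level before 0: shifts and comparison *)

Definition at_pos (z : int) (s : wstate) := s.2 == z.

Definition reach {R : realType} (E : int -> nat * nat -> R) (K : nat) :=
  hit (pright E) move (at_pos K) (at_pos 0).

Definition shift_state (x : int) (s : wstate) : wstate :=
  (fun z => s.1 (z + x), s.2 - x).

Lemma shift_state_move x d s : shift_state x (move d s) = move d (shift_state x s).
Proof.
rewrite /shift_state /move /=; congr pair; last by case: d; lia.
by apply/funext => z; rewrite -subr_eq opprK; case: ifP.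
Qed.

Definition fresh : wstate := (fun=> (0, 0)%N, 1).

Section Reach.
Context {R : realType}.
Implicit Types s t : wstate.

(** Coupling by the same moves: the two walks read the same counts and the same chances while the
    first is positive. When the first is killed at 0, the second is at [a] and may still succeed,
    hence an inequality. *)
Lemma reach_compare (E E' : int -> nat * nat -> R) (a K n : nat) (s t : wstate) :
  (forall z q, 0 <= E z q <= 1) -> (forall z q, 0 <= E' z q <= 1) ->
  (0 < K)%N ->
  (forall z : int, 0 < z -> E z = E' (z + a%:Z)) -> 0 <= s.2 -> t.2 = s.2 + a%:Z ->
  (forall z : int, 0 < z -> t.1 (z + a%:Z) = s.1 z) ->
  reach E K n s <= reach E' (K + a) n t.
Proof.
move=> E01 E'01 K0 EE'.
have p01 t' : 0 <= pright E t' <= 1 by exact: E01.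
have p01' t' : 0 <= pright E' t' <= 1 by exact: E'01.
rewrite /reach; elim: n s t => [|n IH] s t s0 ts tc.
  have [Ds|Ds] := boolP (at_pos K%:Z s); last by rewrite hit0n// (hit_ge0 _ _ p01').
  by rewrite !hit1 //; move: Ds; rewrite /at_pos ts PoszD => /eqP ->.
have [Ds|Ds] := boolP (at_pos K%:Z s).
  by rewrite !hit1 //; move: Ds; rewrite /at_pos ts PoszD => /eqP ->.
have [Cs|Cs] := boolP (at_pos 0 s).
  by rewrite hit0// (hit_ge0 _ _ p01').
have [Dt Ct] : ~~ at_pos (K + a)%N t /\ ~~ at_pos 0 t.
  by move: Ds Cs; rewrite /at_pos ts; lia.
have sp : 0 < s.2 by move: Cs; rewrite /at_pos; lia.
rewrite !hitS//.
have -> : step (pright E') move (hit (pright E') move (at_pos (K + a)%N) (at_pos 0) n) t =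
   pright E s * hit (pright E') move (at_pos (K + a)%N) (at_pos 0) n (move true t) +
   (1 - pright E s) * hit (pright E') move (at_pos (K + a)%N) (at_pos 0) n (move false t).
  by rewrite /step /pright ts tc// EE'.
have le d : hit (pright E) move (at_pos K) (at_pos 0) n (move d s) <=
    hit (pright E') move (at_pos (K + a)%N) (at_pos 0) n (move d t).
  apply: IH => /=; first by case: d; lia.
    by rewrite ts; case: d; lia.
  by move=> z z0; rewrite ts tc//; congr (if _ then _ else _); lia.
by have /andP[q0 q1] := p01 s; rewrite lerD// ler_wpM2l// subr_ge0.
Qed.

(** A nearest-neighbour walk coming from below meets [K] before [L]. *)
Lemma reach_antimono (E : int -> nat * nat -> R) (K L n : nat) s :
  (forall z q, 0 <= E z q <= 1) -> (0 < K <= L)%N -> 0 <= s.2 <= K%:Z ->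
  reach E L n s <= reach E K n s.
Proof.
move=> E01 KL; have p01 t' : 0 <= pright E t' <= 1 by exact: E01.
rewrite /reach; elim: n s => [|n IH] s sK.
  have [Ds|Ds] := boolP (at_pos K%:Z s); first by rewrite [leRHS]hit1// hit_le1.
  have [Cs|Cs] := boolP (at_pos L%:Z s); last by rewrite !hit0n.
  by exfalso; move: Ds Cs; rewrite /at_pos; lia.
have [Ds|Ds] := boolP (at_pos K%:Z s); first by rewrite [leRHS]hit1// hit_le1.
have Ls : ~~ at_pos L%:Z s by move: Ds; rewrite /at_pos; lia.
have [Cs|Cs] := boolP (at_pos 0 s); first by rewrite !hit0.
rewrite !hitS//; apply: (step_le _ _ p01) => d; apply: IH.
by move: Ds Cs; rewrite /at_pos; case: d => /=; lia.
Qed.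

End Reach.

(** * Optional stopping for the walk killed at 0 *)

Section HalfLine.
Context {R : realType}.
Implicit Types s t : wstate.
Variable F : nat * nat -> R.
Hypothesis F_half : forall q, 2^-1 <= F q <= 1.
Local Notation E := (fun _ : int => F).
Local Notation pr := (pright E).
Local Notation stopK K := (predU (at_pos (Posz K)) (at_pos 0)).
Local Notation W := (urn_drift F).

Let p01 (s : wstate) : 0 <= pr s <= 1. Proof. exact: (F01 _ F_half). Qed.

(* W_N - drift is the mean of W_(N-1) after one move, so W, summed over the sites,
   compensates the drift of the position. *)
Lemma drift_supermartingale (K j n : nat) s : 0 <= s.2 <= K%:Z ->
  ev pr move (stopK K) n (fun t => (t.2)%:~R + \sum_(1 <= x < K) W j (t.1 x)) s
  <= (s.2)%:~R + \sum_(1 <= x < K) W (n + j) (s.1 x).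
Proof.
elim: n s => [|n IH] s sK; first by [].
have [st|st] := boolP (stopK K s).
  by rewrite ev_stop// lerD2l ler_sum// => x _; rewrite (urn_drift_mono _ F_half)// leq_addl.
rewrite evS//.
have sp : 0 < s.2 < K%:Z by move: st; rewrite /= /at_pos; lia.
apply: (@le_trans _ _ (step pr move (fun t =>
    (t.2)%:~R + \sum_(1 <= x < K) W (n + j) (t.1 x)) s)).
  by apply: (step_le _ _ p01) => d; apply: IH; case: d => /=; lia.
rewrite stepD.
have -> : step pr move (fun t => (t.2)%:~R) s = (s.2)%:~R + drift F (s.1 s.2).
  by rewrite /step /= rmorphB rmorphD /= /drift /pright; ring.
rewrite -addrA lerD2l step_sum -(sum_delta _ _ _ (drift F (s.1 s.2)) sp) -big_split /=.
apply: ler_sum => x _; rewrite addSn.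
have [xs|xs] := eqVneq x%:Z s.2.
  by rewrite mul1r xs urn_driftS lerD2l /step /= eqxx.
(* A site that is not being left keeps its counts, and one more level of truncation only increases
   its term. *)
rewrite mul0r add0r (le_trans _ (urn_drift_leS _ F_half _ _))// /step /= (negbTE xs).
by rewrite -mulrDl addrC subrK mul1r.
Qed.

(** Counts grow when a site is left, so nonzero counts at [x] show that [x] was met, and met before
    the walk stopped at 0. *)
Lemma visited_le_reach (K x n : nat) s : (0 < x < K)%N -> s.1 x = (0, 0)%N ->
  0 <= s.2 <= x%:Z ->
  ev pr move (stopK K) n (fun t => (t.1 x != (0, 0)%N)%:R) s <= reach E x n s.
Proof.
move=> xK; rewrite /reach; elim: n s => [|n IH] s sx s2.
  by rewrite /= sx eqxx hit_ge0.
have [Ds|Ds] := boolP (at_pos x s).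
  rewrite hit1//; rewrite -[leRHS](ev_cst pr move (stopK K) n.+1 1 s).
  by apply: (ev_le _ _ p01) => t; rewrite lern1 leq_b1.
have [Cs|Cs] := boolP (at_pos 0 s).
  by rewrite ev_stop /= ?Cs ?orbT// sx eqxx (hit_ge0 _ _ p01).
rewrite hitS// evS; last by move: Ds Cs; rewrite /= /at_pos; lia.
apply: (step_le _ _ p01) => d; apply: IH.
  by rewrite /= (_ : (_ == s.2) = false)//; move: Ds; rewrite /at_pos; lia.
by move: Ds Cs; rewrite /at_pos; case: d => /=; lia.
Qed.

(** Counts at the sites up to 0 are never read before the walk is stopped. *)
Lemma reach_fresh (K n : nat) c : (0 < K)%N -> (forall z : int, 0 < z -> c z = (0, 0)%N) ->
  reach E K n (c, 1) = reach E K n fresh.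
Proof.
have F01' := F01 _ F_half; move=> K0 c0.
have le s t : s.2 = 1 -> t.2 = 1 -> (forall z : int, 0 < z -> t.1 z = s.1 z) ->
    reach E K n s <= reach E K n t.
  move=> s1 t1 st; rewrite -[K in leRHS]addn0.
  by apply: reach_compare => //; rewrite ?s1 ?t1// => z z0; rewrite addr0 st.
by apply/le_anti/andP; split; apply: le => //= z /c0 ->.
Qed.

(* Lower bound for the chance that x is left to the right at its first visit and
   never visited again. *)
Definition escape_bound (K x k : nat) (s : wstate) : R :=
  if s.1 x == (0, 0)%N then F (0, 0)%N * reach E (K - x) k fresh * reach E x k s
  else if (s.1 x == (1, 0)%N) && (x%:Z < s.2) then reach E (K - x) k (shift_state x s)
  else 0.

(** At the first visit to [x] all sites beyond [x] are untouched, so after a right move the walk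
    seen from [x] is at 1, as good as [fresh], with target [K - x]. Otherwise the bound is 0 or a
    constant times [hit] with horizon [k], and this is at most the mean of its values one move later
    because [hit] grows with the horizon. *)
Lemma escape_bound_sub (K x k : nat) s : (0 < x < K)%N ->
  (s.1 x = (0, 0)%N -> s.2 <= x%:Z /\ forall z : int, x%:Z < z -> s.1 z = (0, 0)%N) ->
  0 < s.2 < K%:Z ->
  escape_bound K x k s <= step pr move (escape_bound K x k) s.
Proof.
move=> xK sfresh sK.
have F01' := F01 _ F_half.
have eb0 t : 0 <= escape_bound K x k t.
  rewrite /escape_bound; case: ifP => _.
    rewrite !mulr_ge0 ?(hit_ge0 _ _ p01)//.
    by have /andP[] := F01' (0,0)%N.
  by case: ifP => _ //; rewrite (hit_ge0 _ _ p01).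
have step_ge0 : 0 <= step pr move (escape_bound K x k) s.
  by apply: (step_ge_cst _ _ p01) => d.
rewrite {1}/escape_bound; case: ifPn => [/eqP s00|s00].
  have [sx sabove] := sfresh s00.
  have [s2|s2] := eqVneq s.2 x%:Z.
    rewrite [reach E x k s]hit1 ?mulr1; last exact/eqP.
    have -> : F (0, 0)%N = pr s by rewrite /pright s2 s00.
    have /andP[q0 q1] := p01 s.
    rewrite /step -[leLHS]addr0 lerD//; last by rewrite mulr_ge0// subr_ge0.
    rewrite ler_wpM2l// /escape_bound /= s2 eqxx s00 /= ltrDl ltr01.
    rewrite /shift_state /= ?s2 (_ : x%:Z + 1 - x%:Z = 1); last by lia.
    rewrite reach_fresh//; first by lia.
    by move=> z z0 /=; rewrite (_ : (_ == _) = false) ?sabove//; lia.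
  have -> : step pr move (escape_bound K x k) s =
     F (0, 0)%N * reach E (K - x) k fresh * step pr move (reach E x k) s.
    rewrite -stepZ; apply: eq_step => d; rewrite /escape_bound /=.
    by rewrite (_ : (_ == s.2) = false) ?s00//; lia.
  rewrite ler_wpM2l//.
    by rewrite mulr_ge0 ?(hit_ge0 _ _ p01)//; have /andP[] := F01' (0,0)%N.
  rewrite /reach -hitS; [|by []|by rewrite /at_pos; lia].
  exact: (hit_leS _ _ p01).
case: ifPn => [/andP[s10 sx]|//].
have -> : step pr move (escape_bound K x k) s =
    step pr move (fun t => if x%:Z < t.2 then reach E (K - x) k (shift_state x t) else 0) s.
  apply: eq_step => d; rewrite /escape_bound /= (_ : (_ == s.2) = false); last by lia.
  by rewrite (negbTE s00) s10 /=.
have -> : step pr move (fun t => if x%:Z < t.2 then reach E (K - x) k (shift_state x t) else 0) s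
    = step pr move (reach E (K - x) k) (shift_state x s).
  rewrite /step; congr (_ * _ + (1 - _) * _).
  - by rewrite /pright /= subrK.
  - by rewrite ifT ?shift_state_move//= ; lia.
  - by rewrite /pright /= subrK.
  - rewrite -shift_state_move; case: ifPn => // sx'.
    rewrite /reach hit0//; rewrite /at_pos /=; move: sx'; rewrite /=; lia.
rewrite /reach -hitS; last 2 first.
- by rewrite /at_pos /=; lia.
- by rewrite /at_pos /=; lia.
exact: (hit_leS _ _ p01).
Qed.

(** Optional stopping for [escape_bound]. Once the walk has stopped, this is at most the indicator
    of the counts [(1, 0)]: if [x] is unvisited, the walk stopped at 0, where [reach] vanishes.
    [survival] covers the paths that have not stopped. *)
Lemma escape_lower_bound (K x n k : nat) : (0 < x < K)%N ->
  F (0, 0)%N * reach E (K - x) k fresh * reach E x k fresh <=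
  ev pr move (stopK K) n (fun t => (t.1 x == (1, 0)%N)%:R) fresh
  + survival E (stopK K) n fresh.
Proof.
move=> xK.
pose I s := 0 <= s.2 <= K%:Z /\
 (s.1 x = (0, 0)%N -> s.2 <= x%:Z /\ forall z : int, x%:Z < z -> s.1 z = (0, 0)%N).
have Inx t d : I t -> ~~ stopK K t -> I (move d t).
  rewrite /= /at_pos => -[tK tf] st; split; first by case: d => /=; lia.
  rewrite /=; case: eqP => [|xt]; first by case: d.
  move=> /tf[tx tz]; split; first by case: d; lia.
  by move=> z xz; rewrite (_ : (z == t.2) = false) ?tz//; lia.
have -> : F (0, 0)%N * reach E (K - x) k fresh * reach E x k fresh =
  escape_bound K x k fresh by rewrite /escape_bound /=.
have Ifresh : I fresh by split => //=; [lia|move=> _; split => //; lia].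
apply: le_trans (@ev_sub _ _ _ _ p01 I (stopK K) n (escape_bound K x k) _ Inx _ Ifresh) _.
  move=> t [tK tf] st; apply: escape_bound_sub => //.
  by move: st; rewrite /= /at_pos; lia.
rewrite /survival -evD; apply: (@ev_le_in _ _ _ _ p01 I) => // t [tK tf].
rewrite /escape_bound; case: eqP => [t00|_].
  rewrite t00 /= add0r.
  have F01' := F01 _ F_half; have /andP[f0 f1] := F01' (0, 0)%N.
  case: orP => tz /=; last first.
    by rewrite !mulr_ile1 ?mulr_ge0 ?(hit_ge0 _ _ p01) ?(hit_le1 _ _ p01).
  case: tz => tz.
    by exfalso; have [] := tf t00; move: tz; rewrite /at_pos; lia.
  by rewrite [reach E x k t]hit0 ?mulr0//; move: tz; rewrite /at_pos; lia.
case: eqP => _ /=; last by rewrite addr_ge0 ?ler0n.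
case: ifP => _; last by rewrite addr_ge0 ?ler0n.
by rewrite -[leLHS]addr0 lerD ?ler0n// (hit_le1 _ _ p01).
Qed.

End HalfLine.

Lemma inv_nat_small {R : realType} (a e : R) : 0 < e ->
  exists n0 : nat, forall n, (n0 <= n)%N -> (0 < n)%N /\ a / n%:R <= e.
Proof.
move=> e0; exists (Num.truncn (`|a| / e)).+1 => n h.
have n0 : (0 < n)%N by lia.
split=> //; rewrite ler_pdivrMr ?ltr0n// (le_trans (ler_norm a))//.
rewrite mulrC -ler_pdivrMr// ltW// (lt_le_trans (truncnS_gt _))// ler_nat//.
Qed.

(** * The chance of escaping from the half-line vanishes *)

Section NoEscape.
Context {R : realType}.
Variable F : nat * nat -> R.
Hypothesis F_half : forall q, 2^-1 <= F q <= 1.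
Local Notation E := (fun _ : int => F).
Local Notation pr := (pright E).
Local Notation stopK K := (predU (at_pos (Posz K)) (at_pos 0)).
Local Notation W := (urn_drift F).
Local Notation r K n := (reach E K n fresh).

Let F01' := F01 _ F_half.
Let p01 (s : wstate) : 0 <= pr s <= 1. Proof. exact: F01'. Qed.

Lemma survival_fresh (K n : nat) : (0 < n)%N -> (0 < K)%N ->
  survival E (stopK K) n fresh <= K%:R ^+ 2 / n%:R.
Proof.
move=> n0 K0; rewrite ler_pdivlMr ?ltr0n// mulrC.
have -> : survival E (stopK K) n fresh =
    survival E (fun t : wstate => (t.2 == 0) || (t.2 == K%:Z)) n fresh.
  by congr (survival _ _ _ _); apply/funext => t /=; rewrite orbC.
by apply: exit_interval => //=; lia.
Qed.

Lemma reach_fresh_antimono (K L n : nat) : (0 < K <= L)%N -> r L n <= r K n.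
Proof. by move=> KL; apply: reach_antimono => //=; lia. Qed.

(** Finite form of the stopping identity. [e1] bounds both the truncation error of W and the chance
    of not having stopped. [q0 ^+ 2 / 2] bounds the chance of leaving [x] exactly once, to the
    right: [F (0, 0)] is at least 1/2, and the levels [x] and [K - x] are reached at least as easily
    as [K]. *)
Lemma reach_identity_lower (K n j j1 : nat) (v q0 e1 : R) (q : nat -> R) :
  (0 < K)%N -> (j1 <= j)%N ->
  (forall N, W N (0, 0)%N <= v) -> v <= 1 -> v - e1 <= W j (0, 0)%N ->
  (forall x, r x n <= q x <= 1) -> 0 <= q0 -> q0 <= r K n ->
  survival E (stopK K) n fresh <= e1 ->
  K%:R * r K n + (K.-1)%:R * (W j1 (1, 0)%N * (q0 ^+ 2 / 2)) <=
  1 + v * (\sum_(1 <= x < K) q x) + (K.-1)%:R * (e1 * (1 + W j1 (1, 0)%N)).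
Proof.
move=> K0 jj1 Wv v1 vj rq q00 q0r surv.
set w1 := W j1 (1, 0)%N.
have w10 : 0 <= w1 by exact: urn_drift_ge0.
have w0 : 0 <= W j (0, 0)%N by exact: urn_drift_ge0.
have e10 : 0 <= e1 by apply: le_trans surv; apply: survival_ge0.
have up := @drift_supermartingale _ F F_half K j n fresh.
have {up} up : ev pr move (stopK K) n
    (fun t => (t.2)%:~R + \sum_(1 <= x < K) W j (t.1 x)) fresh <= 1 + (K.-1)%:R * v.
  apply: le_trans (up _) _; first by rewrite /=; lia.
  rewrite /= lerD2l (le_trans (ler_sum _ (fun x _ => Wv (n + j)%N)))//.
  by rewrite sumr_const_nat subn1 mulr_natl.
(* At the end an unvisited site still holds all its drift and a site left once, to the right, at
   least [w1]; every other site is bounded below by 0. *)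
have low : ev pr move (stopK K) n (fun t => K%:R * (at_pos K t)%:R +
    \sum_(1 <= x < K) (W j (0, 0)%N + - W j (0, 0)%N * (t.1 x != (0, 0)%N)%:R +
       w1 * (t.1 x == (1, 0)%N)%:R)) fresh <=
   ev pr move (stopK K) n (fun t => (t.2)%:~R + \sum_(1 <= x < K) W j (t.1 x)) fresh.
  apply: (@ev_le_in _ _ _ _ p01 (fun s => 0 <= s.2 <= K%:Z)) => /=; last by lia.
    by move=> t d; rewrite /at_pos; case: d => /=; lia.
  move=> t tK; rewrite lerD//.
    rewrite /at_pos; case: eqP => [->|_]; first by rewrite mulr1.
    by rewrite mulr0 ler0z; lia.
  apply: ler_sum => x _; case: eqP => [->|_] /=; first by rewrite mulr0 addr0 mulr0 addr0.
  rewrite mulr1 subrr add0r; case: eqP => [->|_]; last by rewrite mulr0 urn_drift_ge0.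
  by rewrite mulr1 urn_drift_mono.
have {low up} := le_trans low up.
rewrite evD evZ ev_sum.
rewrite -[ev _ _ _ _ (fun t => (at_pos K t)%:R) _]/(reach E K n fresh).
have sumlow : \sum_(1 <= x < K) (v + - v * q x + w1 * (q0 ^+ 2 / 2) - e1 * (1 + w1)) <=
  \sum_(1 <= x < K) ev pr move (stopK K) n (fun t => W j (0, 0)%N +
     - W j (0, 0)%N * (t.1 x != (0, 0)%N)%:R + w1 * (t.1 x == (1, 0)%N)%:R) fresh.
  rewrite big_nat [leRHS]big_nat; apply: ler_sum => x xK.
  have xK' : (0 < x < K)%N by [].
  rewrite !evD ev_cst !evZ.
  have h1 := @visited_le_reach _ F F_half K x n fresh xK' erefl.
  have {h1} h1 : ev pr move (stopK K) n (fun t => (t.1 x != (0, 0)%N)%:R) fresh <= q x.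
    apply: le_trans (h1 _) _; first by rewrite /=; lia.
    by have /andP[] := rq x.
  have h2 := @escape_lower_bound _ F F_half K x n n xK'.
  have h3 : q0 ^+ 2 / 2 <= F (0, 0)%N * reach E (K - x) n fresh * r x n.
    have /andP[fh _] := F_half (0, 0)%N.
    have ra : q0 <= r (K - x) n.
      apply: le_trans q0r _; apply: reach_fresh_antimono.
      by rewrite subn_gt0 leq_subr andbT; case/andP: xK'.
    have rb : q0 <= r x n.
      apply: le_trans q0r _; apply: reach_fresh_antimono.
      by case/andP: xK' => -> /ltnW.
    rewrite mulrC expr2 mulrA; apply: ler_pM => //.
      by rewrite mulr_ge0// invr_ge0.
    by apply: ler_pM => //; rewrite invr_ge0.
  have h4 : q0 ^+ 2 / 2 - e1 <= ev pr move (stopK K) n (fun t => (t.1 x == (1, 0)%N)%:R) fresh.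
    by rewrite lerBlDr (le_trans h3)// (le_trans h2)// lerD2l.
  have h5 := ler_wpM2l w10 h4.
  (* [h6], [h7] and [h8] together replace [W j (0, 0)] by [v] and the chance of a visit by [q x], at
     a cost of [e1]. *)
  have h6 : 0 <= (W j (0, 0)%N) * (q x - ev pr move (stopK K) n (fun t => (t.1 x != (0, 0)%N)%:R) fresh).
    by rewrite mulr_ge0// subr_ge0.
  have h7 : 0 <= (W j (0, 0)%N - (v - e1)) * (1 - q x).
    by rewrite mulr_ge0// subr_ge0//; have /andP[] := rq x.
  have h8 : 0 <= e1 * q x.
    rewrite mulr_ge0//; have /andP[h _] := rq x; apply: le_trans h.
    exact: (hit_ge0 _ _ p01).
  move: h5 h6 h7 h8; move: (ev _ _ _ _ _ _) => a; move: (ev _ _ _ _ _ _) => b.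
  lra.
have eS : \sum_(1 <= x < K) (v + - v * q x + w1 * (q0 ^+ 2 / 2) - e1 * (1 + w1)) =
   (K.-1)%:R * v - v * (\sum_(1 <= x < K) q x) + (K.-1)%:R * (w1 * (q0 ^+ 2 / 2)) -
   (K.-1)%:R * (e1 * (1 + w1)).
  by rewrite !sumrB !big_split /= -!mulr_sumr !sumr_const_nat subn1 !mulr_natl; ring.
rewrite eS in sumlow.
move: sumlow => /[swap]; move: (\sum_(1 <= x < K) ev _ _ _ _ _ _) => S.
lra.
Qed.

Lemma no_escape :
  (forall N, W N (0, 0)%N <= 1) ->
  ((forall N, W N (1, 0)%N = 0) -> forall N, W N (0, 0)%N = 0) ->
  forall tau : R, 0 < tau -> exists2 K0 : nat, (0 < K0)%N &
    forall K n, (K0 <= K)%N -> r K n <= tau.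
Proof.
move=> W1 Wdeg tau tau0; apply: contrapT => noK0.
have r01 K n : 0 <= r K n <= 1 by rewrite (hit_ge0 _ _ p01) (hit_le1 _ _ p01).
(* The chance of hitting [K] before 0 without a time limit. *)
pose q K := sup (range (fun n => r K n)).
have supq K : has_sup (range (fun n => r K n)).
  split; first by exists (r K 0), 0.
  by exists 1 => _ [n _ <-]; have /andP[] := r01 K n.
have rq K n : r K n <= q K by apply: ub_le_sup; [case: (supq K)|exists n].
have q1 K : q K <= 1.
  by apply: ge_sup; [case: (supq K)|move=> _ [n _ <-]; have /andP[] := r01 K n].
have q0 K : 0 <= q K by apply: le_trans (rq K 0); have /andP[] := r01 K 0.
have qapprox K e : 0 < e -> exists n, q K - e < r K n.
  by move=> e0; have [_ [n _ <-] h] := sup_adherent e0 (supq K); exists n.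
have qmono K L : (0 < K <= L)%N -> q L <= q K.
  move=> KL; apply: ge_sup; first by case: (supq L).
  by move=> _ [n _ <-]; apply: le_trans (rq K n); exact: reach_fresh_antimono.
have qtau K : (0 < K)%N -> tau <= q K.
  move=> K0; rewrite leNgt; apply/negP => qt; apply: noK0; exists K => // L n KL.
  by rewrite (le_trans (rq L n))// (le_trans _ (ltW qt))// qmono// K0.
pose A := range (fun K => q K.+1).
have infA : has_inf A.
  by split; [exists (q 1), 0|exists 0 => _ [K _ <-]].
pose p := inf A.
have pq K : (0 < K)%N -> p <= q K.
  by case: K => // K _; apply: ge_inf; [case: infA|exists K].
have p0 : 0 < p.
  apply: lt_le_trans tau0 _; apply: lb_le_inf; first by case: infA.
  by move=> _ [K _ <-]; exact: qtau.
have papprox e : 0 < e -> exists2 x0 : nat, (0 < x0)%N & forall K, (x0 <= K)%N -> q K <= p + e.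
  move=> e0; have [_ [x _ <-] h] := inf_adherent e0 infA.
  by exists x.+1 => // K xK; rewrite (le_trans _ (ltW h))// qmono.
pose B := range (fun N => W N (0, 0)%N).
have supB : has_sup B.
  by split; [exists (W 0 (0, 0)%N), 0|exists 1 => _ [N _ <-]].
pose v := sup B.
have Wv N : W N (0, 0)%N <= v by apply: ub_le_sup; [case: supB|exists N].
have v1 : v <= 1 by apply: ge_sup; [case: supB|move=> _ [N _ <-]].
have v0 : 0 <= v by rewrite (le_trans _ (Wv 0))// urn_drift0.
have vapprox e : 0 < e -> exists N, v - e < W N (0, 0)%N.
  by move=> e0; have [_ [n _ <-] h] := sup_adherent e0 supB; exists n.
(* The gap comes from the drift left after a single right move, with [q0 = p / 2]. If no such drift
   exists, the degeneracy hypothesis gives [v = 0], and [0 < p] is enough. *)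
have [j1 gap] : exists j1, v * p < p + W j1 (1, 0)%N * ((p / 2) ^+ 2 / 2).
  have [[j1 j1P]|noj] := pselect (exists j1, 0 < W j1 (1, 0)%N).
    exists j1; have : 0 < W j1 (1, 0)%N * ((p / 2) ^+ 2 / 2).
      by rewrite mulr_gt0// divr_gt0// exprn_gt0// divr_gt0.
    have : v * p <= p by rewrite -[leRHS]mul1r ler_wpM2r// ltW.
    lra.
  exists 0%N; rewrite urn_drift0 mul0r addr0.
  suff -> : v = 0 by rewrite mul0r.
  apply/le_anti; rewrite v0 andbT; apply: ge_sup; first by case: supB.
  move=> _ [N _ <-]; rewrite Wdeg// => M; apply/eqP/negPn/negP => WM.
  by apply: noj; exists M; rewrite lt_neqAle eq_sym WM urn_drift_ge0.
set c := W j1 (1, 0)%N * _ in gap.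
have w10 : 0 <= W j1 (1, 0)%N by exact: urn_drift_ge0.
have c0 : 0 <= c by rewrite mulr_ge0// divr_ge0// sqr_ge0.
have main K : (0 < K)%N ->
    K%:R * p + (K.-1)%:R * c <= 1 + v * \sum_(1 <= x < K) q x.
  move=> K0; apply/ler_addgt0Pr => e e0.
  have KR : 0 < K%:R :> R by rewrite ltr0n.
  (* The first bound keeps [r K n] above [p / 2]. In the second, [2 + W j1 (1, 0)] is the factor
     [1 + W j1 (1, 0)] of the identity plus 1 for replacing [r K n] by [p]. *)
  pose e1 := Num.min (p / 2) (e / (K%:R * (2 + W j1 (1, 0)%N))).
  have den0 : 0 < K%:R * (2 + W j1 (1, 0)%N) by rewrite mulr_gt0// ltr_wpDr.
  have e10 : 0 < e1 by rewrite lt_min !divr_gt0.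
  have e1p : e1 <= p / 2 by rewrite ge_min lexx.
  have e1e : e1 * (K%:R * (2 + W j1 (1, 0)%N)) <= e.
    by rewrite -ler_pdivlMr// ge_min lexx orbT.
  have [n1 hn1] := qapprox K _ e10.
  have [n2 hn2] := inv_nat_small (K%:R ^+ 2) _ e10.
  have [j hj] := vapprox _ e10.
  pose n := maxn n1 n2; pose j' := maxn j j1.
  have rn : q K - e1 < r K n.
    apply: lt_le_trans hn1 _; apply: (hit_mono _ _ p01); exact: leq_maxl.
  have [n0 Kn] := hn2 n (leq_maxr _ _).
  have := @reach_identity_lower K n j' j1 v (p / 2) e1 q K0 (leq_maxr _ _) Wv v1.
  move=> /(_ _ _ _ _ _)/wrap[].
  - by rewrite (le_trans (ltW hj))// urn_drift_mono// leq_maxl.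
  - by move=> x; rewrite rq q1.
  - by rewrite divr_ge0// ltW.
  - by have := pq K K0; lra.
  - by rewrite (le_trans (survival_fresh _ _ _ _)).
  rewrite -/c => h.
  have h1 : K%:R * p <= K%:R * r K n + K%:R * e1.
    by rewrite -mulrDr ler_wpM2l// ?ltW//; have := pq K K0; lra.
  have h2 : (K.-1)%:R * (e1 * (1 + W j1 (1, 0)%N)) <= K%:R * (e1 * (1 + W j1 (1, 0)%N)).
    rewrite ler_wpM2r ?ler_nat ?leq_pred// mulr_ge0 ?(ltW e10)// addr_ge0//.
  lra.
(* Half the gap: from [x0] on, each further site adds at least [p + c] to the left of [main] and at
   most [v * (p + e) <= p + c - e] to the right. *)
pose e := (p + c - v * p) / 2.
have e0 : 0 < e by rewrite divr_gt0//; lra.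
have [x0 x00 hx0] := papprox e e0.
have sumq m : \sum_(1 <= x < x0 + m) q x <= x0%:R + m%:R * (p + e).
  elim: m => [|m IH].
    rewrite addn0 mul0r addr0.
    apply: (@le_trans _ _ (\sum_(1 <= x < x0) 1)); first by apply: ler_sum.
    by rewrite sumr_const_nat ler_nat leq_subr.
  rewrite addnS big_nat_recr/=; last exact: ltn_addr.
  by rewrite -natr1 mulrDl mul1r addrA lerD// hx0// leq_addr.
have [m0 hm0] := inv_nat_small (1 + v * x0%:R + c) _ e0.
have [m0p] := hm0 m0.+1 (leqnSn _).
rewrite ler_pdivrMr ?ltr0n//.
set m := m0.+1 => hm.
have := main (x0 + m.+1)%N (ltn_addl _ (ltn0Sn _)).
rewrite addnS /= => h.
have h1 := ler_wpM2l v0 (sumq m.+1).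
rewrite addnS in h1.
have h2 := le_trans h (_ : _ <= 1 + v * (x0%:R + m.+1%:R * (p + e))).
have {h2} := h2 ltac:(by rewrite lerD2l).
move: hm; clearbody m => hm; rewrite -(natr1 (x0 + m)) -(natr1 m) natrD.
have mR : 0 <= m%:R :> R by [].
have x0R : 0 <= x0%:R :> R by [].
have h3 : v * e <= e by rewrite -[leRHS]mul1r ler_wpM2r// ltW.
have h4 : 0 <= x0%:R * p by rewrite mulr_ge0// ltW.
have h5 : 0 <= x0%:R * c by rewrite mulr_ge0.
have eE : e + e = p + c - v * p by rewrite /e; lra.
move: (m%:R : R) (x0%:R : R) mR x0R h4 h5 hm => M X M0 X0 h4 h5 hm hfin.
have h6 : 0 <= (e - v * e) * (M + 1) by rewrite mulr_ge0; lra.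
have eM : (e + e) * (M + 1) = (p + c - v * p) * (M + 1) by rewrite eE.
nra.
Qed.

End NoEscape.

(** * From the half-line to the whole line *)

Definition start : wstate := (fun=> (0, 0)%N, 0).

Definition moves (d : bool) (q : nat * nat) : nat := if d then q.1 else q.2.

Lemma hit_position {R : realType} (E : int -> nat * nat -> R) (K n : nat) (s : wstate) :
  (forall z q, 2^-1 <= E z q <= 1) -> s.2 <= K%:Z ->
  1 - survival E (at_pos K) n s <= hit (pright E) move (at_pos K) pred0 n s.
Proof.
move=> E_half sK; have pE01 := pr01 _ E_half; rewrite lerBlDr /survival.
elim: n s sK => [|n IH] s sK.
  by rewrite /hit /=; case: (at_pos _ _) => /=; rewrite ?addr0 ?add0r.
have [st|st] := boolP (at_pos K s); first by rewrite hit1// ev_stop// st addr0.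
rewrite hitS// evS// -stepD; apply: (step_ge_cst _ _ pE01) => d; apply: IH.
by move: st; rewrite /at_pos; case: d => /=; lia.
Qed.

Section Transfer.
Context {R : realType}.
Variables (E : int -> nat * nat -> R) (F : nat * nat -> R) (eps : R).
Hypothesis E_half : forall z q, 2^-1 <= E z q <= 1.
Hypothesis E_eps : forall z q, E z q <= 1 - eps.
Hypothesis EF : forall z : int, 0 < z -> E z = F.
Hypothesis eps0 : 0 < eps.
Implicit Types s t : wstate.
Local Notation EF' := (fun _ : int => F).

Let F_half q : 2^-1 <= F q <= 1. Proof. by rewrite -(EF 1). Qed.
Let F_eps q : F q <= 1 - eps. Proof. by rewrite -(EF 1). Qed.
Let F01' := F01 _ F_half.
Let pE01 s : 0 <= pright E s <= 1. Proof. exact: pr01. Qed.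
Let pF01 s : 0 <= pright EF' s <= 1. Proof. exact: F01'. Qed.
Let eps_le : eps <= 2^-1.
Proof. by have := F_eps (0, 0)%N; have /andP[] := F_half (0, 0)%N; lra. Qed.

(** Accessibility of [t] from [fresh] without hitting 0, stated through its effect on [reach]: [w]
    stands for the chance of a path of [k] moves, and [K0] puts the target beyond that path. *)
Let reachable t := exists w : R, exists k K0 : nat, 0 < w /\
  forall K n, (K0 <= K)%N -> w * reach EF' K n t <= reach EF' K (n + k) fresh.

Let reachable_move d t : 0 < t.2 -> reachable t -> reachable (move d t).
Proof.
move=> t0 [w [k [K0 [w0 H]]]]; exists (w * eps), k.+1, (maxn K0 `|t.2|.+1).
split=> [|K n]; first by rewrite mulr_gt0.
rewrite geq_max => /andP[K0K tK]; rewrite addnS -addSn.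
apply: le_trans (H K n.+1 K0K); rewrite -mulrA ler_wpM2l ?(ltW w0)//.
rewrite /reach [leRHS]hitS; [|by rewrite /at_pos; lia|by rewrite /at_pos; lia].
have h0 d' : 0 <= reach EF' K n (move d' t) by exact: (hit_ge0 _ _ pF01).
have := h0 true; have := h0 false; rewrite /step /reach.
have := F_eps (t.1 t.2); have /andP[] := F_half (t.1 t.2); rewrite -/(pright EF' t).
move: (pright EF' t) => p p1 p2 pe; have e2 := eps_le.
case: d; move: (hit _ _ _ _ _ (move true t)) (hit _ _ _ _ _ (move false t)) => x y y0 x0.
  have : 0 <= (p - eps) * x by rewrite mulr_ge0//; lra.
  have : 0 <= (1 - p) * y by rewrite mulr_ge0//; lra.
  lra.
have : 0 <= (1 - p - eps) * y by rewrite mulr_ge0//; lra.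
have : 0 <= p * x by rewrite mulr_ge0//; lra.
lra.
Qed.

(* A path of the walk, with its part on the negative half-line erased and the rest
   shifted by 1, is a path from [fresh] that avoids 0. *)
Let mimic b : exists t, [/\ reachable t,
  forall z : int, 0 < z -> t.1 (z + 1) = (run move start b).1 z &
  t.2 = Num.max (run move start b).2 0 + 1].
Proof.
elim/last_ind: b => [|b d [t [rt tc tp]]].
  exists fresh; split => //; exists 1, 0%N, 0%N; split => // K n _.
  by rewrite mul1r addn0.
rewrite run_rcons; set s := run move start b in tc tp *.
have t0 : 0 < t.2 by rewrite tp; lia.
have [/andP[s0 sd]|sN] := boolP ((0 <= s.2) && (d || (0 < s.2))).
  exists (move d t); split; first exact: reachable_move.
    by move=> z z0 /=; rewrite tc// (_ : (_ == t.2) = (z == s.2))//; lia.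
  by move: sd => /=; case: d => /=; lia.
(* Erased moves: those made from a negative site, and the move from 0 to -1. The image does not
   move. *)
exists t; split => //.
  by move=> z z0 /=; rewrite tc// (_ : (_ == s.2) = false)//; lia.
by move: sN => /=; case: d => /=; lia.
Qed.

(** [no_escape] with tolerance [w * tau], where [w] is the price of leading [fresh] to the image of
    the history. The shift by 1 puts that image in the position required by [reach_compare]. *)
Lemma reach_vanishes b :
  (forall N, urn_drift F N (0, 0)%N <= 1) ->
  ((forall N, urn_drift F N (1, 0)%N = 0) -> forall N, urn_drift F N (0, 0)%N = 0) ->
  0 <= (run move start b).2 ->
  forall tau : R, 0 < tau -> exists K0 : nat,
    forall K n, (K0 <= K)%N -> reach E K n (run move start b) <= tau.
Proof.
move=> W1 Wdeg s0 tau tau0.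
have [t [[w [k [K0 [w0 H]]]] tc tp]] := mimic b.
have [K1 K10 H1] := no_escape F F_half W1 Wdeg _ (mulr_gt0 w0 tau0).
exists (maxn K0 K1) => K n; rewrite geq_max => /andP[K0K K1K].
apply: (@le_trans _ _ (reach EF' (K + 1) n t)).
  apply: reach_compare => //.
  - by move=> z q; have /andP[h ->] := E_half z q; rewrite (le_trans _ h)// invr_ge0.
  - exact: leq_trans K1K.
  - by rewrite tp; lia.
rewrite -(ler_pM2l w0); apply: le_trans (H _ _ _) (H1 _ _ _).
  by rewrite (leq_trans K0K)// leq_addr.
by rewrite (leq_trans K1K)// leq_addr.
Qed.

(* At each visit to y the walk makes a move in direction d with chance at least eps. *)
Lemma avoid_direction (d : bool) (y : int) (J n u0 : nat) s :
  moves d (s.1 y) = u0 ->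
  hit (pright E) move (fun t => (J <= moves (~~ d) (t.1 y))%N)
    (fun t => (u0 < moves d (t.1 y))%N) n s
  <= (1 - eps) ^+ (J - moves (~~ d) (s.1 y)).
Proof.
have e01 : 0 <= 1 - eps <= 1 by rewrite gerBl (ltW eps0) andbT; have := eps_le; lra.
elim: n s => [|n IH] s su.
  have [Ds|Ds] := boolP (J <= moves (~~ d) (s.1 y))%N.
    by rewrite hit1// (eqP Ds) expr0.
  by rewrite hit0n// exprn_ge0//; have /andP[] := e01.
have [Ds|Ds] := boolP (J <= moves (~~ d) (s.1 y))%N.
  by rewrite hit1// (eqP Ds) expr0.
rewrite hitS//; last by rewrite su ltnn.
have [sy|sy] := eqVneq s.2 y; last first.
  apply: (step_le_cst _ _ pE01) => d'.
  have e : (move d' s).1 y = s.1 y by rewrite /= eq_sym (negbTE sy).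
  by rewrite -e; apply: IH; rewrite e.
have ey d' : (move d' s).1 y = tally d' (s.1 y) by rewrite /= sy eqxx.
have hd : hit (pright E) move (fun t => (J <= moves (~~ d) (t.1 y))%N)
    (fun t => (u0 < moves d (t.1 y))%N) n (move d s) = 0.
  by apply: hit0; rewrite ey -?su; case: (d) Ds => /=; lia.
have hNd : hit (pright E) move (fun t => (J <= moves (~~ d) (t.1 y))%N)
    (fun t => (u0 < moves d (t.1 y))%N) n (move (~~ d) s) <=
    (1 - eps) ^+ (J - moves (~~ d) (s.1 y)).-1.
  rewrite (_ : _.-1 = J - moves (~~ d) ((move (~~ d) s).1 y))%N.
    by apply: IH; rewrite ey -su; case: (d).
  by rewrite ey; case: (d) Ds => /=; lia.
have -> : step (pright E) move (hit (pright E) move (fun t => (J <= moves (~~ d) (t.1 y))%N)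
    (fun t => (u0 < moves d (t.1 y))%N) n) s =
  (if d then 1 - pright E s else pright E s) *
  hit (pright E) move (fun t => (J <= moves (~~ d) (t.1 y))%N)
    (fun t => (u0 < moves d (t.1 y))%N) n (move (~~ d) s).
  by rewrite /step; case: (d) hd => /= ->; ring.
have -> : (J - moves (~~ d) (s.1 y) = (J - moves (~~ d) (s.1 y)).-1.+1)%N by lia.
rewrite exprS; apply: ler_pM => //.
- by have /andP[] := pE01 s; case: (d); lra.
- exact: (hit_ge0 _ _ pE01).
- have := pr_ge _ E_half s; have := E_eps s.2 (s.1 s.2); rewrite -/(pright E s).
  by have := eps_le; case: (d); lra.
Qed.

End Transfer.

(** * Drift consumed by a recurrent walk *)

Section Forward.
Context {R : realType}.
Variables (E : int -> nat * nat -> R) (F : nat * nat -> R).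
Hypothesis E_half : forall z q, 2^-1 <= E z q <= 1.
Hypothesis EF : forall z : int, 0 < z -> E z = F.
Implicit Types s t : wstate.
Local Notation W := (urn_drift F).

Let F_half q : 2^-1 <= F q <= 1. Proof. by rewrite -(EF 1). Qed.
Let pE01 s : 0 <= pright E s <= 1. Proof. exact: pr01. Qed.

Definition visits (q : nat * nat) : nat := (q.1 + q.2)%N.

Lemma visits_tally d q : visits (tally d q) = (visits q).+1.
Proof. by case: d; rewrite /visits /= ?addnS. Qed.

(* Only the drift of the first N visits to each of the sites 1, ..., K-1 is compensated. *)
Lemma drift_submartingale (K N n : nat) : (0 < K)%N ->
  (K.-1)%:R * W N (0, 0)%N <= K%:R + N%:R *
    \sum_(1 <= x < K) ev (pright E) move (at_pos K) n
       (fun t => (visits (t.1 x) < N)%N%:R) start.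
Proof.
move=> K0.
(* The truncation level drops with each visit, so that a move costs exactly its drift. After [N]
   visits [T] is 0, and later drift is a pure gain. *)
pose T q := W (N - visits q) q.
pose phi s := (s.2)%:~R + \sum_(1 <= x < K) T (s.1 x).
pose I s := s.2 <= K%:Z.
have Inx t d : I t -> ~~ at_pos K t -> I (move d t).
  by rewrite /I /at_pos => tK st; case: d => /=; lia.
have sub : phi start <= ev (pright E) move (at_pos K) n phi start.
  apply: (@ev_sub _ _ _ _ pE01 I) => // s sK st.
  rewrite /phi stepD step_sum.
  have -> : step (pright E) move (fun t => (t.2)%:~R) s =
      (s.2)%:~R + (2 * pright E s - 1).
    by rewrite /step /= rmorphB rmorphD /=; ring.
  have le1 : \sum_(1 <= x < K) (T (s.1 x) - (x%:Z == s.2)%:R * drift F (s.1 s.2)) <=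
     \sum_(1 <= x < K) step (pright E) move (fun t => T (t.1 x)) s.
    rewrite big_nat [leRHS]big_nat; apply: ler_sum => x xK.
    have [xs|xs] := eqVneq x%:Z s.2; last first.
      rewrite mul0r subr0 -[leLHS](step_cst (pright E) move _ s) /step /=.
      by rewrite (negbTE xs).
    have pF : pright E s = F (s.1 s.2) by rewrite /pright EF//; lia.
    have ex d : (move d s).1 x%:Z = tally d (s.1 s.2) by rewrite /= xs eqxx.
    rewrite mul1r /step pF !ex xs /T !visits_tally.
    have [h|h] := ltnP (visits (s.1 s.2)) N; last first.
      have -> : (N - (visits (s.1 s.2)).+1)%N = 0%N by lia.
      have -> : (N - (visits (s.1 s.2)))%N = 0%N by lia.
      by rewrite !urn_drift0 !mulr0 addr0 subr_le0 drift_ge0.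
    have -> : (N - visits (s.1 s.2) = (N - (visits (s.1 s.2)).+1).+1)%N by lia.
    by rewrite urn_driftS addrAC subrr add0r.
  (* At the sites up to 0 the drift is not compensated; it is nonnegative, which suffices for a
     submartingale. *)
  have le2 : \sum_(1 <= x < K) (x%:Z == s.2)%:R * drift F (s.1 s.2) <= 2 * pright E s - 1.
    have [s0|s0] := boolP (0 < s.2).
      rewrite sum_delta; first by rewrite /drift /pright EF.
      by move: st sK; rewrite /I /at_pos s0; lia.
    rewrite big_nat big1 => [|x xK]; last first.
      by rewrite (_ : (_ == _) = false) ?mul0r//; lia.
    by have /andP[] := E_half s.2 (s.1 s.2); rewrite -/(pright E s); lra.
  rewrite sumrB in le1; move: le1 le2; move: (\sum_(_ <= _ < _) _) => a.
  move: (\sum_(_ <= _ < _) _) => b; move: (\sum_(_ <= _ < _) _) => c; lra.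
have e : phi start = (K.-1)%:R * W N (0, 0)%N.
  by rewrite /phi /= add0r /T subn0 sumr_const_nat subn1 mulr_natl.
rewrite -e (le_trans sub)// mulr_sumr -(ev_cst (pright E) move (at_pos K) n K%:R start).
rewrite (eq_bigr (fun x : nat => ev (pright E) move (at_pos K) n
  (fun t => N%:R * (visits (t.1 x) < N)%N%:R) start)); last by move=> x _; rewrite evZ.
rewrite -ev_sum -evD; apply: (@ev_le_in _ _ _ _ pE01 I) => // s sK.
rewrite /phi lerD//; first by rewrite -[K%:R]/((K%:Z)%:~R) ler_int.
apply: ler_sum => x _; case: ltnP => h /=.
  by rewrite mulr1 (le_trans (urn_drift_le _ F_half _ _))// ler_nat leq_subr.
by rewrite /T (eqP h) urn_drift0 mulr0.
Qed.

Local Notation hitN N x z :=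
  (hit (pright E) move (fun t => (N <= visits (t.1 (x : int)))%N) (at_pos z)).

(** Before it stops at [K] the walk passes [x + m], and visits are never lost: [N] visits made
    before [x + m] are still counted at the end. *)
Lemma hit_visits_le (K N n x m : nat) s : (x + m <= K)%N -> s.2 <= (x + m)%N%:Z ->
  hitN N x (x + m)%N%:Z n s <=
  1 - ev (pright E) move (at_pos K) n (fun t => (visits (t.1 x) < N)%N%:R) s.
Proof.
move=> xmK; rewrite lerBrDr.
have persist k t : (N <= visits (t.1 x))%N ->
    ev (pright E) move (at_pos K) k (fun t => (visits (t.1 x) < N)%N%:R) t = 0.
  elim: k t => [|k IH] t tN; first by rewrite /= ltnNge tN.
  rewrite /=; case: ifP => _; first by rewrite ltnNge tN.
  rewrite -[RHS](step_cst (pright E) move 0 t); apply: eq_step => d; apply: IH.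
  by rewrite /=; case: ifP => _ //; rewrite visits_tally (leq_trans tN).
elim: n s => [|n IH] s sx.
  by rewrite /hit /= [(N <= _)%N]leqNgt; case: (_ < _)%N => /=; rewrite ?addr0 ?add0r.
have [Ds|Ds] := boolP (N <= visits (s.1 x))%N; first by rewrite hit1// persist// addr0.
have le1 : ev (pright E) move (at_pos K) n.+1 (fun t => (visits (t.1 x) < N)%N%:R) s <= 1.
  rewrite -[leRHS](ev_cst (pright E) move (at_pos K) n.+1 1 s).
  by apply: (ev_le _ _ pE01) => t; rewrite lern1 leq_b1.
have [Cs|Cs] := boolP (at_pos (x + m)%N s); first by rewrite hit0// add0r.
rewrite hitS// evS; last by move: Cs sx; rewrite /at_pos; lia.
rewrite -stepD; apply: (step_le_cst _ _ pE01) => d; apply: IH.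
by move: Cs; rewrite /at_pos; case: d => /=; lia.
Qed.

(* The walk observed on the sites >= x only, with x sent to 1: site 0 stands for all the
   sites < x and always sends the walk back to 1. *)
Definition reflected (z : int) (q : nat * nat) : R := if z == 0 then 1 else F q.

Let B01 s : 0 <= pright reflected s <= 1.
Proof.
by rewrite /pright /reflected; case: ifP => _; rewrite ?lexx ?ler01//; exact: F01.
Qed.

(** The image [t] waits at 0 while [s] is below [x], so the two walks run on different clocks. *)
Definition observed (x : nat) s t : Prop :=
  t.2 = Num.max (s.2 - x%:Z + 1) 0 /\
  forall z : int, 0 < z -> t.1 z = s.1 (z + x%:Z - 1).

Lemma observed_stay x s t d : (0 < x)%N -> s.2 < x%:Z -> (move d s).2 < x%:Z ->
  observed x s t -> observed x (move d s) t.
Proof.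
move=> x0 sx; rewrite /observed => sd [tp tc]; split; first by lia.
by move=> z z0; rewrite tc//= (_ : (_ == s.2) = false)//; lia.
Qed.

Lemma observed_enter x s t : (0 < x)%N -> s.2 + 1 = x%:Z ->
  observed x s t -> observed x (move true s) (move true t).
Proof.
move=> x0 sx; rewrite /observed /= => -[tp tc]; split; first by rewrite tp; lia.
move=> z z0; rewrite tc// (_ : (_ == t.2) = false); last by rewrite tp; lia.
by rewrite (_ : (_ == s.2) = false)//; lia.
Qed.

Lemma observed_move x s t d : (0 < x)%N -> x%:Z <= s.2 ->
  observed x s t -> observed x (move d s) (move d t).
Proof.
move=> x0 sx; rewrite /observed /= => -[tp tc]; split.
  by rewrite tp; case: d; lia.
by move=> z z0; rewrite tc// tp; congr (if _ then _ else _); lia.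
Qed.

Local Notation hitB N m :=
  (hit (pright reflected) move (fun t => (N <= visits (t.1 1%Z))%N) (at_pos (m.+1)%:Z)).

Section Observed.
Variables (x m N : nat).
Hypothesis x0 : (0 < x)%N.

Let DDeq s t : observed x s t -> visits (t.1 1%Z) = visits (s.1 x%:Z).
Proof. by move=> [_ tc]; rewrite tc//; congr (visits (s.1 _)); lia. Qed.

Let CCeq s t : observed x s t -> at_pos (m.+1)%:Z t = at_pos (x + m)%N s.
Proof. by move=> [tp _]; rewrite /at_pos tp; lia. Qed.

Let pB0 s t : s.2 < x%:Z -> observed x s t -> pright reflected t = 1.
Proof.
by move=> sx [tp _]; rewrite /pright /reflected tp ifT//; lia.
Qed.

Let pBF s t : x%:Z <= s.2 -> observed x s t -> pright reflected t = pright E s.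
Proof.
move=> sx [tp tc]; rewrite /pright /reflected tp ifF; last by lia.
rewrite EF; last by lia.
by rewrite tc; [congr (F (s.1 _)); lia|lia].
Qed.

(** The image skips the time spent below [x], so with the same number of moves it gets at least as
    far. *)
Lemma hit_le_reflected n s t : observed x s t -> s.2 <= (x + m)%N%:Z ->
  hitN N x (x + m)%N n s <= hitB N m n t.
Proof.
elim: n s t => [|n IH] s t st sm.
  by rewrite /hit /= (DDeq _ _ st).
have [Ds|Ds] := boolP (N <= visits (s.1 x))%N.
  by rewrite !hit1//= (DDeq _ _ st).
have [Cs|Cs] := boolP (at_pos (x + m)%N s); first by rewrite hit0// (hit_ge0 _ _ B01).
have Dt : ~~ (N <= visits (t.1 1%Z))%N by rewrite (DDeq _ _ st).
have Ct : ~~ at_pos m.+1 t by rewrite (CCeq _ _ st).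
rewrite hitS//.
have smd d : (move d s).2 <= (x + m)%N%:Z by move: Cs; rewrite /at_pos; case: d => /=; lia.
have [sx|sx] := boolP (x%:Z <= s.2).
  rewrite [leRHS]hitS// [leRHS]/step (pBF _ _ sx st).
  have /andP[q0 q1] := pE01 s.
  by rewrite lerD// ler_wpM2l// ?subr_ge0//; apply: IH => //; apply: observed_move.
have sx' : s.2 < x%:Z by rewrite ltNge.
apply: (step_le_cst _ _ pE01) => d.
have [sd|sd] := boolP ((move d s).2 < x%:Z).
  apply: le_trans (hit_leS _ _ B01 _ _ _ _); apply: IH => //.
  exact: observed_stay.
have dT : d = true by case: d sd => //=; lia.
rewrite dT in sd *; rewrite [leRHS]hitS// /step (pB0 _ _ sx' st) mul1r subrr mul0r addr0.
by apply: IH => //; apply: observed_enter => //; move: sd => /=; lia.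
Qed.

(** The walk may need far more than [k] moves to follow its image. After [n] moves, however, either
    it has met [x + m], and the outcome is decided, or it is counted by [survival]. *)
Lemma reflected_le_hit k n s t : observed x s t -> s.2 <= (x + m)%N%:Z ->
  hitB N m k t <= hitN N x (x + m)%N n s + survival E (at_pos (x + m)%N) n s.
Proof.
elim: n k s t => [|n IH] k s t st sm.
all: have [Ds|Ds] := boolP (N <= visits (s.1 x))%N;
  first by rewrite [hit (pright E) _ _ _ _ _]hit1// (le_trans (hit_le1 _ _ B01 _ _ _ _))// lerDl survival_ge0.
all: have Dt : ~~ (N <= visits (t.1 1%Z))%N by rewrite (DDeq _ _ st).
all: have [Cs|Cs] := boolP (at_pos (x + m)%N s);
  first by rewrite [hit (pright reflected) _ _ _ _ _]hit0 ?(CCeq _ _ st)// addr_ge0 ?survival_ge0// (hit_ge0 _ _ pE01).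
  rewrite /survival /= Cs /= (le_trans (hit_le1 _ _ B01 _ _ _ _))// lerDr.
  exact: (hit_ge0 _ _ pE01).
have Ct : ~~ at_pos m.+1 t by rewrite (CCeq _ _ st).
rewrite [hit (pright E) _ _ _ _ _]hitS// /survival evS// -stepD.
have smd d : (move d s).2 <= (x + m)%N%:Z by move: Cs; rewrite /at_pos; case: d => /=; lia.
have [sx|sx] := boolP (x%:Z <= s.2).
  rewrite (le_trans (hit_leS _ _ B01 _ _ _ _))// hitS// [leLHS]/step (pBF _ _ sx st).
  have /andP[q0 q1] := pE01 s.
  by rewrite lerD// ler_wpM2l// ?subr_ge0//; apply: IH => //; apply: observed_move.
have sx' : s.2 < x%:Z by rewrite ltNge.
apply: (step_ge_cst _ _ pE01) => d.
have [sd|sd] := boolP ((move d s).2 < x%:Z).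
  by apply: IH => //; exact: observed_stay.
have dT : d = true by case: d sd => //=; lia.
rewrite dT in sd *; apply: le_trans (hit_leS _ _ B01 _ _ _ _) _.
rewrite [leLHS]hitS// /step (pB0 _ _ sx' st) mul1r subrr mul0r addr0.
by apply: IH => //; apply: observed_enter => //; move: sd => /=; lia.
Qed.

End Observed.

Lemma hit_before_far (D : pred wstate) n (z : int) s : s.2 + n%:Z < z ->
  hit (pright E) move D (at_pos z) n s = hit (pright E) move D pred0 n s.
Proof.
elim: n s => [|n IH] s sz.
  by [].
have [Ds|Ds] := boolP (D s); first by rewrite !hit1.
have Cs : ~~ at_pos z s by rewrite /at_pos; lia.
by rewrite !hitS//; apply: eq_step => d; apply: IH; case: d => /=; lia.
Qed.

(** Within the horizon [m] given by the hypothesis, the walk started at 0 cannot reach [m + 1], so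
    its [N] visits to 1 precede [m + 1]. The reflected walk carries this estimate, with the same
    [m], to every site [x]. *)
Lemma urn_drift_le1 :
  (forall (N : nat) (tau : R), 0 < tau -> exists n, 1 - tau <=
     hit (pright E) move (fun t => (N <= visits (t.1 1%Z))%N) pred0 n start) ->
  forall N, W N (0, 0)%N <= 1.
Proof.
move=> rec N; apply/ler_addgt0Pr => e e0.
(* Three quarters of [e] pay for [3 * tau] per site, the last one for the terms bounded in [K]. The
   successor avoids dividing by 0. *)
pose tau := e / (4 * N.+1%:R).
have tau0 : 0 < tau by rewrite divr_gt0// mulr_gt0.
have tauN : 4 * N%:R * tau <= e.
  rewrite /tau mulrA ler_pdivrMr ?mulr_gt0// mulrC ler_wpM2l ?(ltW e0)//.
  by rewrite ler_wpM2l// ler_nat.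
move: (tau) tau0 tauN => {}tau tau0 tauN.
have tau3 : 0 <= 3 * tau by rewrite mulr_ge0// ltW.
have [m hm] := rec N tau tau0.
pose t0 : wstate := (fun=> (0, 0)%N, 0).
have obs x : (0 < x)%N -> observed x start t0 by move=> x0; split => //=; lia.
have hB : 1 - tau <= hitB N m m t0.
  apply: le_trans hm _; rewrite -(hit_before_far _ _ (1 + m)%N) /=; last by lia.
  by apply: hit_le_reflected => //=; exact: obs.
have bound K : (0 < K)%N -> (K.-1)%:R * W N (0, 0)%N <=
    K%:R + N%:R * (m%:R + K%:R * (3 * tau)).
  move=> K0.
  have [M0 hM] := inv_nat_small K%:R _ tau0.
  have [M00 KM] := hM M0 (leqnn _).
  have [n0 hn] := inv_nat_small (M0%:R ^+ 2) _ tau0.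
  have [n00 Mn] := hn n0 (leqnn _).
  apply: le_trans (drift_submartingale K N n0 K0) _.
  rewrite lerD2l ler_wpM2l//.
  (* The sites closer than [m] to [K] get the trivial bound 1. At the others, [tau] comes from [hB]
     and [2 * tau] from [survival]. *)
  apply: (@le_trans _ _ (\sum_(1 <= x < K) ((K < x + m)%N%:R + 3 * tau))).
    rewrite big_nat [leRHS]big_nat; apply: ler_sum => x xK.
    have /andP[x0 _] := xK; have [xm|xm] := leqP (x + m) K; last first.
      rewrite -[leLHS]addr0 lerD//.
      rewrite -[leRHS](ev_cst (pright E) move (at_pos K) n0 1 start).
      by apply: (ev_le _ _ pE01) => t; rewrite lern1 leq_b1.
    rewrite /= add0r.
    have h1 := hit_visits_le K N n0 x m start xm isT.
    have h2 := reflected_le_hit x m N x0 m n0 start t0 (obs x x0) isT.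
    have h3 := survival_bound _ E_half (x + m)%N M0 n0 start M00 isT.
    have h4 : survival E (at_pos (x + m)%N) n0 start <= 2 * tau.
      rewrite -(ler_pM2l (_ : 0 < n0%:R)) ?ltr0n//; apply: le_trans h3 _.
      have e1 : M0%:R ^+ 2 <= n0%:R * tau by rewrite mulrC -ler_pdivrMr ?ltr0n.
      have e2 : ((x + m)%N%:Z - start.2)%:~R / M0%:R <= tau.
        rewrite (le_trans _ KM)// ler_wpM2r ?invr_ge0// /= subr0.
        by rewrite -[leLHS]/((x + m)%N%:R) ler_nat.
      have e3 := ler_wpM2l (ler0n R n0) e2.
      by rewrite (_ : 2 * tau = tau + tau) ?mulrDr ?lerD//; ring.
    move: h1 h2 h4 hB; move: (ev _ _ _ _ _ _) (hit _ _ _ _ _ _) (hit _ _ _ _ _ _) => a b c.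
    move: (survival _ _ _ _) => d; lra.
  rewrite big_split /= sumr_const_nat.
  have : \sum_(1 <= x < K) (K < x + m)%N%:R <= m%:R :> R.
    rewrite -natr_sum ler_nat.
    have cnt L : (L <= K -> \sum_(1 <= x < L) (K < x + m)%N <= L + m - K)%N.
      elim: L => [|[|L] IH] LK; [by rewrite big_geq|by rewrite big_geq|].
      rewrite big_nat_recr//=.
      by have := IH (ltnW LK); case: ltnP => /=; lia.
    by rewrite (leq_trans (cnt K _))// addKn.
  have : (3 * tau) *+ (K - 1) <= K%:R * (3 * tau).
    by rewrite -mulr_natl ler_wpM2r// ler_nat leq_subr.
  move: (_ *+ _) => a h1 h2; lra.
rewrite leNgt; apply/negP => We.
have [K0 hK] := inv_nat_small (N%:R * m%:R + W N (0, 0)%N + 1) (e / 4) ltac:(by rewrite divr_gt0).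
have [_] := hK K0.+1 (leqnSn _).
rewrite ler_pdivrMr ?ltr0n// => {}hK.
move: (bound K0.+1 isT) hK; rewrite /= -(natr1 K0) => {}bound hK.
have : 0 <= K0%:R :> R by [].
move: (K0%:R : R) hK bound => K hK bound K00.
have h1 := ler_wpM2r (_ : 0 <= K + 1) tauN.
have := h1 ltac:(lra).
have : 0 <= (W N (0, 0)%N - 1 - e) * (K + 1) by rewrite mulr_ge0//; lra.
lra.
Qed.

End Forward.

(** * Trajectories of a chain *)

Section Trajectories.
Context {R : realType} {S : Type}.
Variables (p : S -> R) (nx : bool -> S -> S) (s0 : S).
Hypothesis p01 : forall s, 0 <= p s <= 1.
Context {d : measure_display} {Omega : measurableType d}.
Variables (P : probability Omega R) (bits : nat -> Omega -> bool).
Hypothesis mbits : forall i, measurable [set w | bits i w].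

Local Notation word n w := (mkseq (bits^~ w) n).
Local Notation state n w := (run nx s0 (word n w)).
Local Notation wt := (weight p nx s0).

(** There are finitely many words of length [n], so every property of them is measurable. *)
Lemma measurable_word n (Q : seq bool -> Prop) : measurable [set w | Q (word n w)].
Proof.
elim: n Q => [|n IH] Q.
  have [q|q] := pselect (Q [::]).
    by rewrite (_ : [set w | _] = setT)//; apply/seteqP; split.
  by rewrite (_ : [set w | _] = set0)//; apply/seteqP; split.
rewrite (_ : [set w | _] =
  ([set w | bits n w] `&` [set w | Q (rcons (word n w) true)]) `|`
  (~` [set w | bits n w] `&` [set w | Q (rcons (word n w) false)])).
  apply: measurableU; apply: measurableI => //.
  - exact: (IH (fun c => Q (rcons c true))).
  - exact: (measurableC (mbits n)).
  - exact: (IH (fun c => Q (rcons c false))).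
apply/seteqP; split=> w /=; rewrite mkseqS.
  by case: (bits n w) => q; [left|right].
by case; case: (bits n w) => -[].
Qed.

Lemma measurable_word_eq n b : measurable [set w | word n w = b].
Proof. exact: (measurable_word n (fun c => c = b)). Qed.

Lemma word_take k n w : (k <= n)%N -> take k (word n w) = word k w.
Proof. by move=> kn; rewrite /mkseq -map_take take_iota (minn_idPl kn). Qed.

Section FromEvents.
Variable Ev : seq bool -> set Omega.
Hypothesis mEv : forall b, measurable (Ev b).
Hypothesis PEv : forall b, P (Ev b) = (wt b)%:E.
Hypothesis Evword : forall b w, Ev b w -> word (size b) w = b.

(** Union of [Ev] over the extensions of [b] by [n] letters. Its probability does not depend on [n],
    since the weights of the two one-letter extensions add up to that of [b]. *)
Let U := fix U n b := if n is n'.+1 then U n' (rcons b true) `|` U n' (rcons b false)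
  else Ev b.

Let mU n b : measurable (U n b).
Proof. by elim: n b => //= n IH b; apply: measurableU. Qed.

Let Uword n b w : U n b w -> word (size b) w = b /\ Ev (word (size b + n) w) w.
Proof.
elim: n b => [|n IH] b /=; first by move=> ev; rewrite addn0 (Evword _ _ ev).
case=> /IH; rewrite size_rcons addSnnS => -[e ev]; split=> //.
  by move: e; rewrite mkseqS => /rcons_inj[].
by move: e; rewrite mkseqS => /rcons_inj[].
Qed.

Let PU n b : P (U n b) = (wt b)%:E.
Proof.
elim: n b => [|n IH] b /=; first exact: PEv.
rewrite measureU//.
  transitivity ((wt (rcons b true))%:E + (wt (rcons b false))%:E)%E.
    by congr (_ + _)%E; exact: IH.
  by rewrite !weight_rcons -EFinD -mulrDr addrC subrK mulr1.
apply/seteqP; split=> // w [/Uword[+ _] /Uword[+ _]].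
by rewrite !size_rcons => -> /rcons_inj[].
Qed.

(** Each [U n [::]] has probability 1. Hence trajectories that are not paths of the chain, such as
    those with forbidden jumps, form a null set. *)
Lemma all_events_negligible : P.-negligible (~` [set w | forall n, Ev (word n w) w]).
Proof.
have -> : ~` [set w | forall n, Ev (word n w) w] = \bigcup_n ~` (U n [::]).
  rewrite -setC_bigcap; congr (~` _); apply/seteqP; split=> w /=.
    move=> ev n _; have := ev n; move: (word n w) (size_mkseq (bits^~ w) n) => b.
    have U0 c b' : Ev (c ++ b') w -> U (size b') c w.
      elim: b' c => [|x b' IH] c /=; first by rewrite cats0.
      by rewrite -cat_rcons => /IH; case: x; [left|right].
    by move=> <- /(U0 [::]).
  by move=> Uw n; have [_] := Uword n [::] w (Uw n I).
apply: negligible_bigcup => n; apply/negligibleP; first exact: measurableC.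
apply: etrans (probability_setC P (mU n [::])) _.
by rewrite PU /= subee.
Qed.

Lemma word_law b : P [set w | word (size b) w = b] = (wt b)%:E.
Proof.
rewrite -PEv; apply/eqP; rewrite eq_le; apply/andP; split; last first.
  apply: le_measure; rewrite ?inE//; last by move=> w; exact: Evword.
  exact: measurable_word_eq.
have [N [mN PN subN]] := all_events_negligible.
apply: (@le_trans _ _ (P (Ev b `|` N))).
  apply: le_measure; rewrite ?inE; [exact: measurable_word_eq|exact: measurableU|].
  move=> w wb; have [|nev] := pselect (forall n, Ev (word n w) w).
    by move=> /(_ (size b)); rewrite wb; left.
  by right; apply: subN.
have h : (P (Ev b `|` N) <= P (Ev b) + P N)%E by exact: measureU2.
by apply: (le_trans h); rewrite [P N]PN adde0.
Qed.

End FromEvents.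

Hypothesis Pword : forall b, P [set w | word (size b) w = b] = (wt b)%:E.

(** [C] is excluded only strictly before the meeting with [D], as in [hit]. *)
Definition hitting (b : seq bool) (D C : pred S) (n : nat) : set Omega :=
  [set w | word (size b) w = b /\ exists i, [/\ (i <= n)%N, D (state (size b + i) w)
     & forall j, (j < i)%N -> ~~ C (state (size b + j) w)]].

Lemma measurable_hitting b D C n : measurable (hitting b D C n).
Proof.
pose Q (c : seq bool) := take (size b) c = b /\ exists i, [/\ (i <= n)%N,
  D (run nx s0 (take (size b + i) c)) &
  forall j, (j < i)%N -> ~~ C (run nx s0 (take (size b + j) c))].
rewrite (_ : hitting b D C n = [set w | Q (word (size b + n) w)]).
  exact: (measurable_word _ Q).
apply/seteqP; split=> w; rewrite /hitting /Q /= word_take ?leq_addr// => -[e [i [ilen Di Ci]]];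
  split=> //; exists i; split=> //; move: Di; rewrite ?word_take ?leq_add2l// => _ j ji;
  by have := Ci j ji; rewrite ?word_take ?leq_add2l// ltnW// (leq_trans ji).
Qed.

Lemma hitting_law b D C n :
  P (hitting b D C n) = (wt b * hit p nx D C n (run nx s0 b))%:E.
Proof.
have word0 b' : hitting b' D C 0 = if D (run nx s0 b') then
    [set w | word (size b') w = b'] else set0.
  apply/seteqP; split=> w.
    move=> [e [i []]]; rewrite leqn0 => /eqP ->; rewrite addn0 e => Db.
    by rewrite Db.
  case: ifPn => // Db /= e; split=> //; exists 0%N; split=> //.
  by rewrite addn0 e.
elim: n b => [|n IH] b.
  rewrite word0 /hit /=; case: ifP => _; first by rewrite Pword mulr1.
  by rewrite measure0 mulr0.
have [Db|Db] := boolP (D (run nx s0 b)).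
  rewrite hit1// mulr1 -Pword; congr (P _); apply/seteqP; split=> w; first by case.
  by move=> /= e; split=> //; exists 0%N; split=> //; rewrite addn0 e.
have [Cb|Cb] := boolP (C (run nx s0 b)).
  rewrite hit0// mulr0 -[RHS](measure0 P); congr (P _); apply/seteqP; split=> // w.
  move=> [e [[|i] [_ Di Ci]]]; first by move: Di; rewrite addn0 e (negbTE Db).
  by have := Ci 0%N isT; rewrite addn0 e Cb.
rewrite (_ : hitting b D C n.+1 =
    hitting (rcons b true) D C n `|` hitting (rcons b false) D C n).
  rewrite measureU; [|exact: measurable_hitting|exact: measurable_hitting|].
    transitivity ((wt (rcons b true) * hit p nx D C n (run nx s0 (rcons b true)))%:E +
        (wt (rcons b false) * hit p nx D C n (run nx s0 (rcons b false)))%:E)%E.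
      by congr (_ + _)%E; exact: IH.
    by rewrite -EFinD !weight_rcons hitS// /step !run_rcons; congr EFin; ring.
  apply/seteqP; split=> // w [[+ _] [+ _]].
  by rewrite !size_rcons => -> /rcons_inj[].
apply/seteqP; split=> w.
  move=> [e [[|i] [iln Di Ci]]]; first by move: Di; rewrite addn0 e (negbTE Db).
  have H x : bits (size b) w = x -> hitting (rcons b x) D C n w.
    move=> bx; split; first by rewrite size_rcons mkseqS e bx.
    exists i; rewrite size_rcons addSnnS; split=> // j ji.
    by rewrite addSnnS; apply: Ci.
  by case: (bits (size b) w) H => H; [left|right]; apply: H.
have H x : hitting (rcons b x) D C n w -> hitting b D C n.+1 w.
  move=> [+ [i [iln Di Ci]]]; rewrite size_rcons mkseqS => /rcons_inj[e _].
  split=> //; exists i.+1; rewrite size_rcons addSnnS in Di; split=> //.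
  case=> [|j] ji; first by rewrite addn0 e.
  by have := Ci j ji; rewrite size_rcons addSnnS.
by case; apply: H.
Qed.

Definition ever_hitting (b : seq bool) (D C : pred S) : set Omega :=
  \bigcup_n hitting b D C n.

Lemma measurable_ever_hitting b D C : measurable (ever_hitting b D C).
Proof. by apply: bigcup_measurable => n _; exact: measurable_hitting. Qed.

Lemma ever_hitting_le b D C (tau : R) :
  (forall n, hit p nx D C n (run nx s0 b) <= tau) -> (P (ever_hitting b D C) <= tau%:E)%E.
Proof.
move=> ht; have cvgP : (P \o hitting b D C) @ \oo --> P (ever_hitting b D C).
  apply: nondecreasing_cvg_mu.
  - by move=> n; exact: measurable_hitting.
  - exact: measurable_ever_hitting.
  - move=> n m nm; apply/subsetPset => w [e [i [iln Di Ci]]]; split=> //.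
    by exists i; split=> //; exact: leq_trans nm.
rewrite -(cvg_lim _ cvgP)//; apply: lime_le; first by apply/cvg_ex; eexists; exact: cvgP.
apply: nearW => n /=; rewrite hitting_law lee_fin.
rewrite (le_trans _ (ht n))// ler_piMl//; first exact: (hit_ge0 _ _ p01).
exact: (weight_le1 _ _ p01).
Qed.

Lemma ever_hitting_ge b D C n :
  ((wt b * hit p nx D C n (run nx s0 b))%:E <= P (ever_hitting b D C))%E.
Proof.
rewrite -hitting_law; apply: le_measure; rewrite ?inE.
- exact: measurable_hitting.
- exact: measurable_ever_hitting.
- by move=> w hw; exists n.
Qed.

Lemma ever_hitting_all_negligible b (D C : nat -> pred S) :
  (forall tau : R, 0 < tau -> exists j, forall n, hit p nx (D j) (C j) n (run nx s0 b) <= tau) ->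
  P.-negligible (\bigcap_j ever_hitting b (D j) (C j)).
Proof.
move=> H.
have m : measurable (\bigcap_j ever_hitting b (D j) (C j)).
  by apply: bigcap_measurable => // j _; exact: measurable_ever_hitting.
apply/negligibleP => //; apply/eqP; rewrite eq_le measure_ge0 andbT.
apply/lee_addgt0Pr => e e0; rewrite add0e; have [j /ever_hitting_le hj] := H e e0.
apply: le_trans hj; apply: le_measure; rewrite ?inE//; first exact: measurable_ever_hitting.
by move=> w /(_ j I).
Qed.

Lemma never_hitting_negligible b D C :
  wt b = 1 ->
  (forall tau : R, 0 < tau -> exists n, 1 - tau <= hit p nx D C n (run nx s0 b)) ->
  P.-negligible (~` ever_hitting b D C).
Proof.
move=> wb H; have m := measurable_ever_hitting b D C.
apply/negligibleP; first exact: measurableC.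
apply: etrans (probability_setC P m) _.
suff -> : P (ever_hitting b D C) = 1%E by rewrite subee.
apply/eqP; rewrite eq_le probability_le1//=; apply/lee_addgt0Pr => e e0.
have [n hn] := H e e0; have := ever_hitting_ge b D C n; rewrite wb mul1r => h.
apply: (@le_trans _ _ ((1 - e)%:E + e%:E)%E); first by rewrite -EFinD subrK.
by rewrite leeD2r// (le_trans _ h)// lee_fin.
Qed.

Lemma measurable_state (phi : S -> R) n (D : set Omega) :
  measurable_fun D (fun w => phi (state n w)).
Proof.
move=> mD Y mY; apply: measurableI => //.
exact: (measurable_word n (fun c => Y (phi (run nx s0 c)))).
Qed.

Lemma state_integral (phi : S -> R) n b : (forall s, 0 <= phi s) ->
  (\int[P]_(w in [set w | word (size b) w = b]) (phi (state (size b + n) w))%:E)%E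
  = (wt b * ev p nx xpred0 n phi (run nx s0 b))%:E.
Proof.
move=> phi0.
elim: n b => [|n IH] b.
  rewrite addn0 (eq_integral (cst (phi (run nx s0 b))%:E)); last first.
    by move=> w; rewrite inE /= => ->.
  rewrite integral_cst; last exact: measurable_word_eq.
  by rewrite [X in (_ * X)%E](Pword b) -EFinM mulrC.
rewrite (_ : [set w | _] = [set w | word (size (rcons b true)) w = rcons b true] `|`
   [set w | word (size (rcons b false)) w = rcons b false]).
  rewrite ge0_integral_setU//.
  - have := IH (rcons b true); have := IH (rcons b false).
    rewrite !size_rcons !addSnnS => -> ->.
    by rewrite -EFinD !weight_rcons /= /step !run_rcons; congr EFin; ring.
  - exact: measurable_word_eq.
  - exact: measurable_word_eq.
  - by apply/measurable_EFinP; exact: measurable_state.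
  - by move=> w _; rewrite lee_fin.
  - apply/disj_setPS => w /= []; rewrite !size_rcons => -> /rcons_inj[].
    by [].
apply/seteqP; split=> w /=; rewrite !size_rcons !mkseqS.
  by move=> ->; case: (bits (size b) w); [left|right].
by case=> /rcons_inj[].
Qed.

End Trajectories.

(** * The law of the urn *)

Section IntegralOffNull.
Import HBNNSimple.
Context {d : measure_display} {T : measurableType d} {R : realType}.
Variable mu : {measure set T -> \bar R}.
Variable N : set T.
Hypotheses (mN : measurable N) (N0 : mu N = 0%E).

(** A simple function below [f], set to 0 on [N], is a simple function below [g] with the same
    integral; measurability is used for simple functions alone. *)
Let le_off (f g : T -> \bar R) : (forall t, 0 <= f t)%E -> (forall t, 0 <= g t)%E ->
  (forall t, ~ N t -> f t = g t) -> (\int[mu]_t f t <= \int[mu]_t g t)%E.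
Proof.
move=> f0 g0 fg; rewrite ge0_integralE// [leRHS]ge0_integralE// !patch_setT.
apply: ge_ereal_sup => _ [h hf <-]; apply: ereal_sup_ubound.
pose h' := mul_nnsfun h (indic_nnsfun R (measurableC mN)).
have h'E t : h' t = h t * (t \in ~` N)%:R.
  by transitivity (h t * \1_(~` N) t); [by []|rewrite indicE].
exists h' => [t|].
  rewrite h'E.
  have [tN|tN] := pselect (N t).
    by rewrite memNset ?mulr0//; exact.
  by rewrite mem_set// mulr1 -fg.
rewrite -!integralT_nnsfun; apply: ge0_ae_eq_integral => //.
- by apply/measurable_EFinP; exact: measurable_funP.
- by apply/measurable_EFinP; exact: measurable_funP.
- by move=> t _; rewrite lee_fin.
- by move=> t _; rewrite lee_fin.
exists N; split=> // t /= nt; apply: contrapT => tN; apply: nt => _.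
congr EFin; apply: etrans (h'E t) _.
by rewrite mem_set// mulr1.
Qed.

(* Needed because [f] is arbitrary outside [0, 1], so the integrand of the theorem may fail
   to be measurable on a null set. *)
Lemma integral_off_null (f g : T -> \bar R) :
  (forall t, ~ N t -> f t = g t) -> (\int[mu]_t f t = \int[mu]_t g t)%E.
Proof.
move=> fg; rewrite integralE [RHS]integralE.
have e h h' : (forall t, 0 <= h t)%E -> (forall t, 0 <= h' t)%E ->
    (forall t, ~ N t -> h t = h' t) -> (\int[mu]_t h t = \int[mu]_t h' t)%E.
  move=> h0 h'0 hh'; apply/eqP; rewrite eq_le !le_off// => t tN.
  by rewrite hh'.
congr (_ - _)%E; apply: e => // t tN.
  by rewrite !funeposE fg.
by rewrite !funenegE fg.
Qed.

End IntegralOffNull.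

Lemma weight_prod {R : realType} {S : Type} (p : S -> R) nx s b :
  weight p nx s b = \prod_(k < size b)
    (if nth false b k then p (run nx s (take k b)) else 1 - p (run nx s (take k b))).
Proof.
elim/last_ind: b => [|b d IH]; first by rewrite big_ord0.
rewrite weight_rcons IH size_rcons big_ord_recr /=; congr (_ * _).
  apply: eq_bigr => k _; rewrite nth_rcons ltn_ord -cats1 takel_cat//.
  exact: ltnW.
by rewrite nth_rcons ltnn eqxx -cats1 takel_cat// take_size.
Qed.

Section UrnLaw.
Context {R : realType}.
Variables (f : R -> R) (a l : R).
Hypotheses (f_half : forall x, 0 <= x <= 1 -> 2^-1 <= f x <= 1).
Hypotheses (a01 : 0 <= a <= 1) (l0 : 0 < l).

Definition proportion (q : nat * nat) : R := (a * l + q.1%:R) / (l + (q.1 + q.2)%N%:R).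

Lemma proportion01 q : 0 <= proportion q <= 1.
Proof.
have /andP[a0 a1] := a01.
have den : 0 < l + (q.1 + q.2)%:R by rewrite ltr_wpDr.
rewrite /proportion divr_ge0 ?(ltW den)//; last by rewrite addr_ge0// mulr_ge0// ltW.
rewrite ler_pdivrMr// mul1r lerD//; first by rewrite ler_piMl// ltW.
by rewrite ler_nat leq_addr.
Qed.

Local Notation F := (fun q => f (proportion q)).
Local Notation urn := (run tally (0, 0)%N).

Let F_half q : 2^-1 <= F q <= 1. Proof. exact/f_half/proportion01. Qed.

Lemma urn_size b : ((urn b).1 + (urn b).2 = size b)%N.
Proof.
elim/last_ind: b => // b d IH; rewrite run_rcons size_rcons -IH.
by case: d => /=; rewrite ?addnS.
Qed.

Definition urn_values (b : seq bool) : seq R :=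
  mkseq (fun i => proportion (urn (take i b))) (size b).+1.

(** Urn recursion cleared of denominators. It also reads the draw off two consecutive proportions,
    which is how [bits] is obtained from [alpha]. *)
Lemma proportion_tally d q :
  (l + (q.1 + q.2)%N%:R + 1) * proportion (tally d q) =
  (l + (q.1 + q.2)%N%:R) * proportion q + d%:R.
Proof.
have den : l + (q.1 + q.2)%:R != 0 by rewrite gt_eqF// ltr_wpDr.
have den1 : l + (q.1 + q.2)%:R + 1 != 0 by rewrite gt_eqF// addr_gt0// ltr_wpDr.
rewrite /proportion.
have -> : l + ((tally d q).1 + (tally d q).2)%:R = l + (q.1 + q.2)%:R + 1.
  by case: d => /=; rewrite ?addnS ?addSn -natr1 addrA.
have -> : ((tally d q).1)%:R = q.1%:R + d%:R :> R by case: d; rewrite /= ?natr1 ?addr0.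
by rewrite [LHS]mulrC divfK// [X in _ = X + _]mulrC divfK// addrA.
Qed.

Lemma urn_path_prob_weight b :
  urn_path_prob f a l (urn_values b) = weight F tally (0, 0)%N b.
Proof.
have -> : urn_path_prob f a l (urn_values b) = \prod_(k < size b)
    urn_step_prob f (l + k%:R) (nth 0 (urn_values b) k) (nth 0 (urn_values b) k.+1).
  rewrite /urn_path_prob size_mkseq.
  have -> : nth 0 (urn_values b) 0 = a.
    by rewrite /urn_values nth_mkseq// take0 /proportion /= !addr0 mulfK// gt_eqF.
  by rewrite eqxx mul1r.
rewrite weight_prod; apply: eq_bigr => k _.
move: (nat_of_ord k) (ltn_ord k) => {}k kb.
have nthv i : (i <= size b)%N -> nth 0 (urn_values b) i = proportion (urn (take i b)).
  by move=> ib; rewrite nth_mkseq.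
rewrite !nthv ?(ltnW kb)//.
rewrite (take_nth false kb) run_rcons.
set q := run _ _ _; set x := nth _ _ _.
have kq : (q.1 + q.2 = k)%N by rewrite urn_size size_takel// ltnW.
have den1 : l + k%:R + 1 != 0 by rewrite gt_eqF// addr_gt0// ltr_wpDr.
have e := proportion_tally x q; rewrite kq in e.
have -> : proportion (tally x q) = ((l + k%:R) * proportion q + x%:R) / (l + k%:R + 1).
  by rewrite -e mulrC mulKf.
(* The two possible successors differ by [1 / (l + k + 1)], so exactly one of the two tests
   succeeds. *)
rewrite /urn_step_prob; case: x {e}; rewrite ?[true%:R]/(1 : R) ?[false%:R]/(0 : R).
  rewrite eqxx ifF ?addr0//; apply/negbTE; rewrite (inj_eq (mulIf _)) ?invr_eq0//.
  by rewrite -subr_eq0 addrAC subrr add0r oner_eq0.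
rewrite addr0 eqxx ifF ?add0r//; apply/negbTE; rewrite (inj_eq (mulIf _)) ?invr_eq0//.
by rewrite eq_sym -subr_eq0 addrAC subrr add0r oner_eq0.
Qed.

Context {d : measure_display} {T : measurableType d}.
Variables (Q : probability T R) (alpha : nat -> T -> R).
Hypothesis malpha : forall k, measurable_fun setT (alpha k).
Hypothesis alpha_law : forall (n : nat) (s : seq R), size s = n.+1 ->
  Q [set t | forall i, (i < n.+1)%N -> alpha i t = nth 0 s i]
    = (urn_path_prob f a l s)%:E.

Let bits i t := (l + i%:R + 1) * alpha i.+1 t - (l + i%:R) * alpha i t == 1.

Let mbits i : measurable [set t | bits i t].
Proof.
rewrite (_ : [set t | _] =
  (fun t => (l + i%:R + 1) * alpha i.+1 t - (l + i%:R) * alpha i t) @^-1` [set 1]).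
  rewrite -[X in measurable X]setTI; apply: measurable_funB => //.
    exact: measurable_funM.
  exact: measurable_funM.
by apply/seteqP; split=> t /eqP.
Qed.

Let Ev (b : seq bool) : set T :=
  [set t | forall i, (i < (size b).+1)%N -> alpha i t = nth 0 (urn_values b) i].

Let mEv b : measurable (Ev b).
Proof.
rewrite (_ : Ev b = \bigcap_i (if (i < (size b).+1)%N then
   setT `&` alpha i @^-1` [set nth 0 (urn_values b) i] else setT)).
  apply: bigcap_measurable => // i _; case: ifP => // _.
  exact: malpha.
apply/seteqP; split=> t /=.
  by move=> H i _; case: ifP => // ib; split=> //; apply: H.
by move=> H i ib; have := H i I; rewrite ib => -[].
Qed.

Let QEv b : Q (Ev b) = (weight F tally (0, 0)%N b)%:E.
Proof. by rewrite -urn_path_prob_weight -(alpha_law (size b))// size_mkseq. Qed.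

Let Evword b t : Ev b t -> mkseq (bits^~ t) (size b) = b.
Proof.
move=> ev; apply: (@eq_from_nth _ false); rewrite size_mkseq// => k kb.
have al i : (i <= size b)%N -> alpha i t = proportion (urn (take i b)).
  by move=> ib; rewrite ev// /urn_values nth_mkseq.
rewrite nth_mkseq// /bits !al ?(ltnW kb)//.
rewrite (take_nth false kb) run_rcons; set q := run _ _ _; set x := nth _ _ _.
have kq : (q.1 + q.2 = k)%N by rewrite urn_size size_takel// ltnW.
have e := proportion_tally x q; rewrite kq in e; rewrite e addrAC subrr add0r.
by case: x {e}; rewrite ?eqxx// eq_sym oner_eq0.
Qed.

Lemma urn_expected_drift :
  (\int[Q]_t (\sum_(0 <= k <oo) ((2 * f (alpha k t) - 1)%:E)) =
   \sum_(0 <= k <oo) (ev F tally xpred0 k (drift F) (0, 0)%N)%:E)%E.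
Proof.
have [N [mN QN subN]] := all_events_negligible F tally (0, 0)%N Q bits _ mEv QEv Evword.
rewrite (integral_off_null Q N mN QN _ (fun t =>
    \sum_(0 <= k <oo) (drift F (urn (mkseq (bits^~ t) k)))%:E)%E); last first.
  move=> t tN; have evt : forall n, Ev (mkseq (bits^~ t) n) t.
    by apply: contrapT => nev; apply: tN; apply: subN.
  apply: eq_eseriesr => k _; rewrite (evt k) ?size_mkseq//.
  rewrite /urn_values nth_mkseq ?size_mkseq// take_oversize ?size_mkseq//.
rewrite integral_nneseries//; first last.
- by move=> k t _; rewrite lee_fin; apply: drift_ge0.
- move=> k; apply/measurable_EFinP; exact: (measurable_state tally (0, 0)%N bits mbits (drift F)).
apply: eq_eseriesr => k _.
have := @state_integral _ _ F tally (0, 0)%N _ _ Q bits mbits _ (drift F) k [::].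
rewrite /= mul1r (_ : [set w | _] = setT); last by apply/seteqP; split.
move=> -> //; last by move=> q; exact: drift_ge0.
exact: (word_law _ _ _ _ _ mbits _ mEv QEv Evword).
Qed.

Lemma urn_expected_drift_le1 :
  ((\int[Q]_t (\sum_(0 <= k <oo) ((2 * f (alpha k t) - 1)%:E)) <= 1)%E) <->
  (forall N, urn_drift F N (0, 0)%N <= 1).
Proof.
have ge0 k : (0 <= (ev F tally xpred0 k (drift F) (0, 0)%N)%:E)%E.
  by rewrite lee_fin; exact: urn_drift_term_ge0.
rewrite urn_expected_drift; split=> [le1 N|le1].
  rewrite -lee_fin; apply: le_trans le1.
  rewrite /urn_drift -sumEFin -(big_mkord xpredT
    (fun k => (ev F tally xpred0 k (drift F) (0, 0)%N)%:E)).
  by apply: nneseries_lim_ge => k _ _; exact: ge0.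
apply: lime_le; first by apply: is_cvg_nneseries => k _ _; exact: ge0.
apply: nearW => N; rewrite big_mkord sumEFin lee_fin; exact: le1.
Qed.

End UrnLaw.

(** * The law of the walk *)

Section Deterministic.
Variable bits : nat -> bool.
Local Notation st n := (run move start (mkseq bits n)).

Lemma stS n : st n.+1 = move (bits n) (st n).
Proof. by rewrite mkseqS run_rcons. Qed.

Lemma st_le n : (st n).2 <= n%:Z.
Proof.
elim: n => // n IH; rewrite stS /=.
by case: (bits n); lia.
Qed.

Lemma st_count_mono d y n k :
  (moves d ((st n).1 y) <= moves d ((st (n + k)).1 y))%N.
Proof.
elim: k => [|k IH]; first by rewrite addn0.
rewrite addnS stS (leq_trans IH)//= ; case: ifP => // _.
by case: (bits _); case: (d).
Qed.

Hypothesis unbounded : forall K : nat, exists i, (st i).2 = K%:Z.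
Hypothesis no_last_zero : forall N : nat, 0 <= (st N).2 ->
  ~ (forall j : nat, exists2 i, (st (N + i)).2 = (N + j.+1)%N%:Z &
      forall k, (k < i)%N -> (st (N + k)).2 != 0).
Hypothesis no_avoidance : forall (N : nat) (d : bool) (y : int),
  ~ (forall J : nat, exists2 i, (J <= moves (~~ d) ((st (N + i)).1 y))%N &
      forall k, (k < i)%N -> ~~ (moves d ((st N).1 y) < moves d ((st (N + k)).1 y))%N).

Let io y := forall N : nat, exists2 n, (N <= n)%N & (st n).2 = y.

(** After a last visit to 0 the sign is constant. It is positive, because all levels are met, and
    then every far level is met without a return to 0. *)
Let io0 : io 0.
Proof.
move=> N; apply: contrapT => noz.
have nz n : (N <= n)%N -> (st n).2 != 0.
  by move=> Nn; apply/negP => /eqP z; apply: noz; exists n.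
have pos k : ((0 < (st (N + k)).2) = (0 < (st N).2)).
  elim: k => [|k IH]; first by rewrite addn0.
  have := nz (N + k)%N (leq_addr _ _); have := nz (N + k).+1 (leqW (leq_addr _ _)).
  by rewrite addnS stS /=; move: IH; case: (bits _); lia.
(* The position never exceeds the time, so the level [N + j.+1] can be met only after time [N]. *)
have late (j : nat) i : (st i).2 = (N + j.+1)%N%:Z -> exists k, i = (N + k)%N.
  move=> ij; exists (i - N)%N; have := st_le i; lia.
have stN : 0 < (st N).2.
  have [i ij] := unbounded (N + 1); have [k ik] := late 0%N i ij.
  by rewrite -(pos k) -ik ij; lia.
apply: (no_last_zero N (ltW stN)) => j.
have [i ij] := unbounded (N + j.+1); have [k ik] := late j i ij.
exists k; first by rewrite -ik.
by move=> k' _; apply: nz; exact: leq_addr.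
Qed.

(** If the neighbour were avoided from some time on, all the later departures from [y], infinitely
    many, would be in the other direction. *)
Let io_next d y : io y -> io (if d then y + 1 else y - 1).
Proof.
move=> ioy N; apply: contrapT => avoid.
have turn n : (N <= n)%N -> (st n).2 = y -> bits n = ~~ d.
  move=> Nn sy; apply: contrapT => bn; apply: avoid; exists n.+1; first exact: leqW.
  by rewrite stS /= sy; case: (d) bn; case: (bits n).
have const k : moves d ((st (N + k)).1 y) = moves d ((st N).1 y).
  elim: k => [|k IH]; first by rewrite addn0.
  rewrite -IH addnS stS /=; case: eqP => // sy.
  by rewrite turn ?leq_addr//; case: (d).
apply: (no_avoidance N d y) => J.
suff [i Ji] : exists i, (J <= moves (~~ d) ((st (N + i)).1 y))%N.
  by exists i => // k _; rewrite const ltnn.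
elim: J => [|J [i Ji]]; first by exists 0%N.
have [n Nn ny] := ioy (N + i)%N.
have nN : (N <= n)%N by apply: leq_trans Nn; exact: leq_addr.
exists (n - N).+1; rewrite addnS subnKC// stS /= ny eqxx (turn _ nN ny).
have := st_count_mono (~~ d) y (N + i) (n - (N + i)); rewrite subnKC//.
by case: (d) Ji => /=; lia.
Qed.

Lemma deterministic_recurrence x (N : nat) : exists2 n, (N <= n)%N & (st n).2 = x.
Proof.
suff : io x by apply.
have H (n : nat) : io n%:Z /\ io (- n%:Z).
  elim: n => [|n [IHp IHn]]; first by rewrite oppr0; split; exact: io0.
  split; first by have := io_next true _ IHp; rewrite /= (_ : _ + 1 = n.+1%:Z)//; lia.
  by have := io_next false _ IHn; rewrite /= (_ : _ - 1 = - n.+1%:Z)//; lia.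
have [x0|x0] := lerP 0 x.
  by have [h _] := H `|x|%N; rewrite (_ : x = `|x|%N%:Z)//; lia.
by have [_ h] := H `|x|%N; rewrite (_ : x = - `|x|%N%:Z)//; lia.
Qed.

End Deterministic.

(** * Identification of the walk with the chain, and almost sure recurrence *)

Section WalkLaw.
Context {R : realType}.
Variables (f : R -> R) (a0 l0 : int -> R).

Definition walk_env (z : int) (q : nat * nat) : R := f (proportion (a0 z) (l0 z) q).

Definition walk_path (b : seq bool) : seq int :=
  mkseq (fun i => (run move start (take i b)).2) (size b).+1.

Lemma nth_walk_path b i : (i <= size b)%N ->
  nth 0 (walk_path b) i = (run move start (take i b)).2.
Proof. by move=> ib; rewrite nth_mkseq. Qed.

Lemma tally_walk_path b k x : (k <= size b)%N ->
  ((run move start (take k b)).1 x).1 = Uvis (walk_path b) k x /\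
  (((run move start (take k b)).1 x).1 + ((run move start (take k b)).1 x).2)%N
    = Lvis (walk_path b) k x.
Proof.
rewrite /Uvis /Lvis; move: (nth 0 (walk_path b)) (nth_walk_path b) => v vE.
elim: k => [|k IH] kb; first by rewrite take0 !big_ord0.
have [IHU IHL] := IH (ltnW kb).
rewrite !big_ord_recr /= -IHU -IHL !vE// ?(ltnW kb)//.
rewrite (take_nth false kb) run_rcons; set s := run _ _ _; set d := nth _ _ _.
rewrite /= [x == s.2]eq_sym; case: eqP => [<-|_] /=; last by rewrite !addn0.
case: d => /=; rewrite ?eqxx ?addn1 ?addn0 ?addSn ?addnS//.
by rewrite (_ : (_ == _) = false) ?addn0//; lia.
Qed.

Lemma walk_path_prob_weight b :
  walk_path_prob f a0 l0 (walk_path b) = weight (pright walk_env) move start b.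
Proof.
rewrite /walk_path_prob size_mkseq nth_walk_path// take0 eqxx mul1r weight_prod.
apply: eq_bigr => k _; move: (nat_of_ord k) (ltn_ord k) => {}k kb.
rewrite /walk_step_prob /alpha_tilde !nth_walk_path// ?(ltnW kb)//.
have [<- <-] := tally_walk_path b k (run move start (take k b)).2 (ltnW kb).
rewrite (take_nth false kb) run_rcons; set s := run _ _ _; set d := nth _ _ _.
rewrite /pright /walk_env /proportion; case: d => /=; first by rewrite eqxx.
by rewrite ifF ?eqxx//; lia.
Qed.

Context {d : measure_display} {Omega : measurableType d}.
Variables (P : probability Omega R) (X : nat -> Omega -> int).
Hypothesis mX : forall (n : nat) (z : int), measurable [set w | X n w = z].
Hypothesis X_law : forall (n : nat) (p : seq int), size p = n.+1 ->
  P [set w | forall i, (i < n.+1)%N -> X i w = nth 0%R p i]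
    = (walk_path_prob f a0 l0 p)%:E.

Definition walk_bits i w := X i.+1 w == X i w + 1.

Lemma measurable_countable_union (I : countType) (A : I -> set Omega) :
  (forall i, measurable (A i)) -> measurable [set w | exists i, A i w].
Proof.
move=> mA; rewrite (_ : [set w | _] = \bigcup_n oapp A set0 (unpickle n)).
  apply: bigcupT_measurable => n.
  by case: unpickle => [i|] /=; [exact: mA|exact: measurable0].
apply/seteqP; split=> w /=.
  by move=> [i Ai]; exists (pickle i) => //; rewrite pickleK.
by move=> [n _]; case: unpickle => //= i Ai; exists i.
Qed.

Lemma measurable_walk_bits i : measurable [set w | walk_bits i w].
Proof.
rewrite (_ : [set w | _] =
    [set w | exists z, ([set w | X i w = z] `&` [set w | X i.+1 w = z + 1]) w]).
  by apply: measurable_countable_union => z; apply: measurableI.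
apply/seteqP; split=> w /=; rewrite /walk_bits.
  by move=> /eqP e; exists (X i w).
by move=> [z [<- ->]].
Qed.

Let Ev (b : seq bool) : set Omega :=
  [set w | forall i, (i < (size b).+1)%N -> X i w = nth 0 (walk_path b) i].

Let mEv b : measurable (Ev b).
Proof.
rewrite (_ : Ev b = \bigcap_i (if (i < (size b).+1)%N then
   [set w | X i w = nth 0 (walk_path b) i] else setT)).
  by apply: bigcap_measurable => // i _; case: ifP.
apply/seteqP; split=> w /=.
  by move=> H i _; case: ifP => // ib; apply: H.
by move=> H i ib; have := H i I; rewrite ib.
Qed.

Let PEv b : P (Ev b) = (weight (pright walk_env) move start b)%:E.
Proof. by rewrite -walk_path_prob_weight -(X_law (size b))// size_mkseq. Qed.

Let Evword b w : Ev b w -> mkseq (walk_bits^~ w) (size b) = b.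
Proof.
move=> ev; apply: (@eq_from_nth _ false); rewrite size_mkseq// => k kb.
have Xp i : (i <= size b)%N -> X i w = (run move start (take i b)).2.
  by move=> ib; rewrite ev// nth_walk_path.
rewrite nth_mkseq// /walk_bits !Xp ?(ltnW kb)//.
rewrite (take_nth false kb) run_rcons /=.
by case: (nth _ _ _); lia.
Qed.

Lemma walk_word_law b : P [set w | mkseq (walk_bits^~ w) (size b) = b] =
  (weight (pright walk_env) move start b)%:E.
Proof. exact: (word_law _ _ _ _ _ measurable_walk_bits _ mEv PEv Evword). Qed.

Lemma walk_position_ae : P.-negligible (~` [set w | forall n,
  X n w = (run move start (mkseq (walk_bits^~ w) n)).2]).
Proof.
apply: negligibleS (all_events_negligible _ _ _ P walk_bits _ mEv PEv Evword).
apply: subsetC => w evw n /=; rewrite (evw n) ?size_mkseq//.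
by rewrite nth_walk_path ?size_mkseq// take_oversize ?size_mkseq.
Qed.

Definition recurrent : set Omega :=
  [set w | forall (x : int) (N : nat), exists2 n : nat, (N <= n)%N & X n w = x].

Lemma measurable_recurrent : measurable recurrent.
Proof.
have mC (x : int) (N : nat) : measurable [set w | exists2 n : nat, (N <= n)%N & X n w = x].
  rewrite (_ : [set w | _] = \bigcup_n (if (N <= n)%N then [set w | X n w = x] else set0)).
    by apply: bigcupT_measurable => n; case: ifP => _; [exact: mX|exact: measurable0].
  apply/seteqP; split=> w /=; first by move=> [n Nn Xn]; exists n => //; rewrite Nn.
  by move=> [n _]; case: ifP => // Nn Xn; exists n.
rewrite (_ : recurrent = ~` [set w | exists xN : int * nat,
    (~` [set w | exists2 n : nat, (xN.2 <= n)%N & X n w = xN.1]) w]).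
  by apply: measurableC; apply: measurable_countable_union => xN; apply: measurableC.
apply/seteqP; split=> w /=; first by move=> rw [[x N]] /=; apply; exact: rw.
by move=> h x N; apply: contrapT => no; apply: h; exists (x, N).
Qed.

Lemma negligible_countable_union (I : countType) (A : I -> set Omega) :
  (forall i, P.-negligible (A i)) -> P.-negligible [set w | exists i, A i w].
Proof.
move=> nA; rewrite (_ : [set w | _] = \bigcup_n oapp A set0 (unpickle n)).
  apply: negligible_bigcup => n.
  by case: unpickle => [i|] /=; [exact: nA|exact: negligible_set0].
apply/seteqP; split=> w /=.
  by move=> [i Ai]; exists (pickle i) => //; rewrite pickleK.
by move=> [n _]; case: unpickle => //= i Ai; exists i.
Qed.

Variables (F : nat * nat -> R) (eps : R).
Hypothesis E_half : forall z q, 2^-1 <= walk_env z q <= 1.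
Hypothesis E_eps : forall z q, walk_env z q <= 1 - eps.
Hypothesis EF : forall z : int, 0 < z -> walk_env z = F.
Hypothesis eps0 : 0 < eps.

Let p01 s : 0 <= pright walk_env s <= 1. Proof. exact: pr01. Qed.
Local Notation ehit := (ever_hitting move start walk_bits).
Local Notation st n w := (run move start (mkseq (walk_bits^~ w) n)).

Let in_ever_hitting N (D C : pred wstate) w :
  (exists2 i, D (st (N + i) w) & forall k, (k < i)%N -> ~~ C (st (N + k) w)) ->
  ehit (mkseq (walk_bits^~ w) N) D C w.
Proof.
move=> [i Di Ci]; exists i => //; rewrite /hitting /= size_mkseq; split=> //.
by exists i; split.
Qed.

Lemma recurrent_of_drift_le1 :
  (forall N, urn_drift F N (0, 0)%N <= 1) ->
  ((forall N, urn_drift F N (1, 0)%N = 0) -> forall N, urn_drift F N (0, 0)%N = 0) ->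
  P recurrent = 1%E.
Proof.
move=> W1 Wdeg.
suff nrec : P.-negligible (~` recurrent).
  have mr := measurableC measurable_recurrent.
  rewrite -[recurrent]setCK; apply: etrans (probability_setC P mr) _.
  by rewrite [P _](measure_negligible mr nrec) sube0.
(* Exceptional events: a level is never met ([A1]); after some history all far levels are met before
   0 ([A2]); after some history a site is left arbitrarily often in one direction before any
   departure in the other ([A3]). *)
pose A1 (K : nat) : set Omega := ~` ehit [::] (at_pos K) pred0.
pose A2 (b : seq bool) : set Omega := if 0 <= (run move start b).2 then
  \bigcap_j ehit b (at_pos (size b + j.+1)%N) (at_pos 0) else set0.
pose A3 (bdy : seq bool * bool * int) : set Omega :=
  let: (b, d, y) := bdy in
  \bigcap_J ehit b (fun t => (J <= moves (~~ d) (t.1 y))%N)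
    (fun t => (moves d ((run move start b).1 y) < moves d (t.1 y))%N).
have n1 K : P.-negligible (A1 K).
  apply: (never_hitting_negligible _ _ _ _ _ measurable_walk_bits walk_word_law) => //.
  move=> tau tau0.
  have [M hM] := inv_nat_small (K%:R + 1 : R) _ (divr_gt0 tau0 (ltr0n _ 2)).
  have [M0 KM] := hM M (leqnn _).
  have [n hn] := inv_nat_small (M%:R ^+ 2 : R) _ (divr_gt0 tau0 (ltr0n _ 2)).
  have [n0 Mn] := hn n (leqnn _).
  exists n; apply: le_trans (hit_position _ K n start E_half _); last by [].
  rewrite lerD2l lerN2.
  have := survival_bound _ E_half K M n start M0 ltac:(by []).
  rewrite /= subr0 -ler_pdivlMl ?ltr0n// mulrDr mulKf ?pnatr_eq0 -?lt0n//.
  move=> /le_trans; apply.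
  rewrite [leRHS](splitr tau) lerD//; first by rewrite mulrC.
  by apply: le_trans KM; rewrite ler_wpM2r ?invr_ge0// lerDl.
have n2 b : P.-negligible (A2 b).
  rewrite /A2; case: ifP => b0; last exact: negligible_set0.
  apply: (ever_hitting_all_negligible _ _ _ p01 _ _ measurable_walk_bits walk_word_law).
  move=> tau tau0.
  have [K0 HK] := reach_vanishes _ F eps E_half E_eps EF eps0 b W1 Wdeg b0 tau tau0.
  by exists K0 => n; apply: HK; lia.
have n3 bdy : P.-negligible (A3 bdy).
  case: bdy => -[b d'] y.
  apply: (ever_hitting_all_negligible _ _ _ p01 _ _ measurable_walk_bits walk_word_law).
  move=> tau tau0.
  have e1 : `|1 - eps| < 1.
    have /andP[h1 _] := E_half 0 (0, 0)%N; have h2 := E_eps 0 (0, 0)%N.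
    by rewrite ltr_norml gtrBl eps0 andbT; lra.
  have [m hm] : exists m : nat, (1 - eps) ^+ m <= tau.
    have /cvgrPdist_lt/(_ tau tau0)[m _ hm] := cvg_expr e1.
    exists m; have := hm m (leqnn m); rewrite /= sub0r normrN => /ltW.
    exact: le_trans (ler_norm _).
  (* The moves already made from [y] during the history have to be discounted. *)
  exists (m + moves (~~ d') ((run move start b).1 y))%N => n.
  apply: le_trans (avoid_direction _ F eps E_half E_eps EF eps0 d' y _ n _ _ erefl) _.
  by rewrite addnK.
have := negligibleU walk_position_ae (negligibleU (negligible_countable_union _ _ n1)
  (negligibleU (negligible_countable_union _ _ n2) (negligible_countable_union _ _ n3))).
apply: negligibleS => w /= nrec; apply: contrapT => good; apply: nrec.
have Xst n : X n w = (st n w).2.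
  by apply: contrapT => ne; apply: good; left => h; apply: ne; exact: h.
move=> x N.
have [|||n Nn xn] := @deterministic_recurrence (walk_bits^~ w) _ _ _ x N;
  last by exists n => //; rewrite Xst.
- move=> K; apply: contrapT => noK; apply: good; right; left; exists K.
  by move=> [n _ [_ [i [_ /eqP iK _]]]]; apply: noK; exists i.
- move=> N' s0 h; apply: good; right; right; left.
  exists (mkseq (walk_bits^~ w) N'); rewrite /A2 s0 size_mkseq => j _.
  by apply: in_ever_hitting; have [i /eqP ij] := h j; exists i.
- move=> N' d' y h; apply: good; right; right; right.
  exists (mkseq (walk_bits^~ w) N', d', y) => J _.
  by apply: in_ever_hitting; have [i] := h J; exists i.
Qed.

(** Recurrence yields [N] visits to 1 almost surely. If no finite horizon gave them chance
    [1 - tau], continuity from below would bound that probability by [1 - tau]. *)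
Lemma drift_le1_of_recurrent : P recurrent = 1%E -> forall N, urn_drift F N (0, 0)%N <= 1.
Proof.
move=> rec1.
apply: (urn_drift_le1 _ F E_half EF) => N tau tau0; apply: contrapT => small.
have hit_small n : hit (pright walk_env) move (fun t => (N <= visits (t.1 1%Z))%N) pred0 n start
    <= 1 - tau.
  by rewrite leNgt; apply/negP => h; apply: small; exists n; exact: ltW.
have le1 := @ever_hitting_le _ _ _ _ start p01 _ _ P walk_bits measurable_walk_bits walk_word_law
  [::] (fun t => (N <= visits (t.1 1%Z))%N) pred0 _ hit_small.
have [Z [mZ PZ subZ]] := walk_position_ae.
have : (P recurrent <= P (ehit [::] (fun t => (N <= visits (t.1 1%Z))%N) pred0 `|` Z))%E.
  apply: le_measure; rewrite ?inE.
  - exact: measurable_recurrent.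
  - by apply: measurableU => //; exact: (measurable_ever_hitting _ _ _ measurable_walk_bits).
  move=> w rw; have [Xst|nXst] := pselect (forall n, X n w = (st n w).2); last first.
    by right; apply: subZ.
  left.
  suff [i Ni] : exists i, (N <= visits ((st i w).1 1%Z))%N.
    by exists i => //; split=> //; exists i; split.
  elim: N {small hit_small le1} => [|N [i Ni]]; first by exists 0%N.
  have [n ni nX] := rw 1 i.
  have s1 : (st n w).2 = 1%Z by rewrite -Xst nX.
  have mono d' : (moves d' ((st i w).1 1%Z) <= moves d' ((st n w).1 1%Z))%N.
    by have := st_count_mono (walk_bits^~ w) d' 1%Z i (n - i); rewrite subnKC.
  exists n.+1; rewrite mkseqS run_rcons.
  rewrite [(move _ _).1 _]/= s1 eqxx visits_tally ltnS (leq_trans Ni)//.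
  exact: (leq_add (mono true) (mono false)).
rewrite rec1 => /le_trans h.
have h2 : (P (ehit [::] (fun t => (N <= visits (t.1 1%Z))%N) pred0 `|` Z) <= (1 - tau)%:E)%E.
  have h3 : (P (ehit [::] (fun t => (N <= visits (t.1 1%Z))%N) pred0 `|` Z) <=
     P (ehit [::] (fun t => (N <= visits (t.1 1%Z))%N) pred0) + P Z)%E.
    apply: measureU2 => //; exact: (measurable_ever_hitting _ _ _ measurable_walk_bits).
  by apply: (le_trans h3); rewrite [P Z]PZ adde0.
have := h _ h2; rewrite lee_fin; lra.
Qed.

End WalkLaw.

(** * Urns without drift after one right draw *)

Section Degenerate.
Context {R : realType}.
Variable F : nat * nat -> R.
Hypothesis F_half : forall q, 2^-1 <= F q <= 1.
Hypothesis F_lt1 : forall q, F q < 1.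

(** All terms of [urn_driftS] are nonnegative and both draws have positive chance, so vanishing
    passes to both successors. *)
Lemma urn_drift_eq0 q : (forall N, urn_drift F N q = 0) ->
  drift F q = 0 /\ forall d N, urn_drift F N (tally d q) = 0.
Proof.
have W0 := urn_drift_ge0 _ F_half; have g0 := drift_ge0 _ F_half q.
have /andP[Fh _] := F_half q; have F1 := F_lt1 q.
have Fpos : 0 < F q by rewrite (lt_le_trans _ Fh)// invr_gt0.
move=> Wq; have key N : [/\ drift F q = 0, F q * urn_drift F N (tally true q) = 0 &
    (1 - F q) * urn_drift F N (tally false q) = 0].
  have := Wq N.+1; rewrite urn_driftS /step.
  have h1 : 0 <= F q * urn_drift F N (tally true q) by rewrite mulr_ge0// ltW.
  have h2 : 0 <= (1 - F q) * urn_drift F N (tally false q).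
    by rewrite mulr_ge0// subr_ge0 ltW.
  by move=> h; split; lra.
split=> [|d N]; first by have [] := key 0%N.
have [_ /eqP ht /eqP hf] := key N.
move: ht hf; rewrite !mulf_eq0 gt_eqF//= subr_eq0 (gt_eqF F1) /=.
by case: d => /eqP h1 /eqP h2.
Qed.

Lemma urn_drift_eq0_right (u v : nat) :
  (forall N, urn_drift F N (1, 0)%N = 0) -> drift F (u.+1, v) = 0.
Proof.
move=> W10; suff H N : urn_drift F N (u.+1, v) = 0.
  by have [] := urn_drift_eq0 _ (H : forall N, urn_drift F N (u.+1, v) = 0).
elim: v u N => [|v IHv] u N; last first.
  by have [_ /(_ false N)] := urn_drift_eq0 (u.+1, v) (IHv u).
elim: u N => [|u IHu] N; first exact: W10.
by have [_ /(_ true N)] := urn_drift_eq0 (u.+1, 0)%N IHu.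
Qed.

End Degenerate.

(** With [u] the integer part of [x * n] and [v = n - u], the numerator differs from
    [x * (l + n + 1)] by at most [l + 2], whatever [n]. *)
Lemma proportion_dense {R : realType} (a l x e : R) :
  0 <= a <= 1 -> 0 < l -> 0 <= x <= 1 -> 0 < e ->
  exists u v : nat, `|proportion a l (u.+1, v) - x| < e.
Proof.
move=> /andP[a0 a1] l0 /andP[x0 x1] e0.
have [n hn] := inv_nat_small (l + 2) _ (divr_gt0 e0 (ltr0n R 2)).
have [_ {}hn] := hn n.+1 (leqnSn _).
pose u := Num.truncn (x * n%:R).
have xn0 : 0 <= x * n%:R by rewrite mulr_ge0.
have ux : u%:R <= x * n%:R by rewrite truncn_le.
have xu : x * n%:R < u%:R + 1 by rewrite natr1 truncnS_gt.
have un : (u <= n)%N.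
  by rewrite -(ler_nat R) (le_trans ux)// ler_piMl.
exists u, (n - u)%N; rewrite /proportion /= addSn subnKC//.
have den : 0 < l + n.+1%:R by rewrite ltr_wpDr.
have -> : (a * l + u.+1%:R) / (l + n.+1%:R) - x =
    (a * l + u.+1%:R - x * (l + n.+1%:R)) / (l + n.+1%:R).
  by rewrite mulrBl mulfK// gt_eqF.
rewrite normrM [`|_^-1|]gtr0_norm ?invr_gt0//.
apply: (@le_lt_trans _ _ (e / 2)); last by rewrite ltr_pdivrMr// mulr_natr mulr2n ltrDl.
rewrite ler_pdivrMr// (@le_trans _ _ (l + 2))//.
  have al0 : 0 <= a * l by rewrite mulr_ge0// ltW.
  have al1 : a * l <= l by rewrite ler_piMl// ltW.
  have xl0 : 0 <= x * l by rewrite mulr_ge0// ltW.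
  have xl1 : x * l <= l by rewrite ler_piMl// ltW.
  by rewrite ler_norml -!natr1 mulrDr mulrDr mulr1; apply/andP; split; lra.
move: hn; rewrite ler_pdivrMr ?ltr0n// => /le_trans; apply.
by rewrite ler_wpM2l ?divr_ge0 ?(ltW e0)// lerDr ltW.
Qed.

Lemma C3_continuous {R : realType} (f : R -> R) : C3_on_01 f ->
  exists2 g : R -> R, continuous g & forall x, 0 <= x <= 1 -> g x = f x.
Proof.
move=> [g [gf [dg _]]]; exists g => // x.
exact/differentiable_continuous/derivable1_diffP/(dg 0%N x).
Qed.

(** A continuous function attains its maximum on [[0, 1]], and that value is below 1. *)
Lemma C3_lt1 {R : realType} (f : R -> R) : C3_on_01 f ->
  (forall x, 0 <= x <= 1 -> f x < 1) ->
  exists2 eps : R, 0 < eps & forall x, 0 <= x <= 1 -> f x <= 1 - eps.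
Proof.
move=> /C3_continuous[g cg gf] f1.
have [c c01 gc] := @EVT_max R g 0 1 ler01 (continuous_subspaceT cg).
move: c01; rewrite in_itv/= => c01.
exists (1 - f c); first by rewrite subr_gt0 f1.
move=> x x01; rewrite subKr -!gf//; apply: gc.
by rewrite in_itv/=.
Qed.

Lemma urn_drift_degenerate {R : realType} (f : R -> R) (a l : R) :
  C3_on_01 f -> (forall x, 0 <= x <= 1 -> 2^-1 <= f x < 1) ->
  0 <= a <= 1 -> 0 < l ->
  let F q := f (proportion a l q) in
  (forall N, urn_drift F N (1, 0)%N = 0) -> forall N, urn_drift F N (0, 0)%N = 0.
Proof.
move=> /C3_continuous[g cg gf] fh a01 l0 F W10.
have p01 q : 0 <= proportion a l q <= 1 by exact: proportion01.
have F_half q : 2^-1 <= F q <= 1.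
  by have /andP[h1 h2] := fh _ (p01 q); rewrite h1 ltW.
have F_lt1 q : F q < 1 by have /andP[] := fh _ (p01 q).
have f_half x : 0 <= x <= 1 -> f x = 2^-1.
  move=> x01; apply/eqP; rewrite eq_le; have /andP[-> _] := fh _ x01; rewrite andbT.
  rewrite leNgt; apply/negP => fx.
  have d0 : 0 < f x - 2^-1 by rewrite subr_gt0.
  have /cvgrPdist_lt/(_ _ d0) := cg x.
  move=> /nbhs_ballP[e /= e0 he].
  have [u [v uv]] := proportion_dense a l x e a01 l0 x01 e0.
  have := he (proportion a l (u.+1, v)); rewrite /ball /= distrC => /(_ uv).
  rewrite !gf//; have := urn_drift_eq0_right F F_half F_lt1 u v W10.
  by rewrite /drift /F => h /ltr_distlBl; lra.
have drift0 q : drift F q = 0 by rewrite /drift /F f_half// mulfV ?subrr.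
have W0 N q : urn_drift F N q = 0.
  elim: N q => [|N IH] q; first exact: urn_drift0.
  by rewrite urn_driftS drift0 add0r /step !IH !mulr0 addr0.
by move=> N; exact: W0.
Qed.

Theorem theorem1 (R : realType) (f : R -> R)
  (* f : [0,1] -> (0,1), C^3, isolated fixed points, f >= 1/2 *)
  (hf01 : forall x, 0 <= x <= 1 -> 0 < f x < 1)
  (hC3 : C3_on_01 f)
  (hfix : isolated_fixed_points f)
  (hhalf : forall x, 0 <= x <= 1 -> 2^-1 <= f x)
  (* initial environment w0 = (alpha0^x, l0^x)_x, constant for x >= 1 *)
  (a0 l0 : int -> R)
  (ha0 : forall x, 0 <= a0 x <= 1)
  (hl0 : forall x, 0 < l0 x)
  (hconst : forall x : int, 1 <= x -> a0 x = a0 1 /\ l0 x = l0 1)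
  (* the walk X with law P_{0,w0} *)
  (d : measure_display) (Omega : measurableType d) (P : probability Omega R)
  (X : nat -> Omega -> int)
  (hXmeas : forall (n : nat) (z : int), measurable [set w | X n w = z])
  (hXlaw : forall (n : nat) (p : seq int), size p = n.+1 ->
     P [set w | forall i, (i < n.+1)%N -> X i w = nth 0%R p i]
       = (walk_path_prob f a0 l0 p)%:E)
  (* an urn process (alpha_k, l_k) associated to f, started from w0^1 *)
  (d' : measure_display) (T : measurableType d') (Q : probability T R)
  (alpha : nat -> T -> R)
  (halmeas : forall k, measurable_fun setT (alpha k))
  (hallaw : forall (n : nat) (s : seq R), size s = n.+1 ->
     Q [set t | forall i, (i < n.+1)%N -> alpha i t = nth 0%R s i]
       = (urn_path_prob f (a0 1) (l0 1) s)%:E) :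
  P [set w | forall (x : int) (N : nat), exists2 n : nat, (N <= n)%N & X n w = x]
    = 1%E
  <->
  (\int[Q]_t (\sum_(0 <= k <oo) ((2 * f (alpha k t) - 1)%:E)) <= 1)%E.
Proof.
have f_half x : 0 <= x <= 1 -> 2^-1 <= f x <= 1.
  by move=> x01; rewrite hhalf//= ltW//; have /andP[] := hf01 _ x01.
have f_lt1 x : 0 <= x <= 1 -> f x < 1 by move=> x01; have /andP[] := hf01 _ x01.
pose F q := f (proportion (a0 1) (l0 1) q).
have E_half z q : 2^-1 <= walk_env f a0 l0 z q <= 1 by exact/f_half/proportion01.
have EF (z : int) : 0 < z -> walk_env f a0 l0 z = F.
  by move=> z0; have [ea el] := hconst z z0; rewrite /walk_env ea el.
have urnE := urn_expected_drift_le1 f (a0 1) (l0 1) f_half (ha0 1) (hl0 1) Q alpha halmeas hallaw.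
split=> [rec|le1].
  apply/urnE.
  exact: (drift_le1_of_recurrent f a0 l0 P X hXmeas hXlaw F E_half EF rec).
have [eps eps0 f_eps] := C3_lt1 f hC3 f_lt1.
apply: (recurrent_of_drift_le1 f a0 l0 P X hXmeas hXlaw F eps E_half _ EF eps0).
- by move=> z q; exact/f_eps/proportion01.
- exact/urnE.
- apply: (urn_drift_degenerate f (a0 1) (l0 1)) => // x x01.
  by rewrite hhalf//= f_lt1.
Qed.
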